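(* Let $G$ be a finite solvable group and let $F(G)$ be the Fitting subgroup of $G$. Then $$\operatorname{cp}(G)\le |G:F(G)|^{-1/2}.$$ Moreover, if $\alpha(G)>1/2$, then $$|G:F(G)|\le (2\alpha(G)-1)^{-4}.$$
   Context: For a finite group $G$, $c(G)$ denotes the number of cyclic subgroups of $G$ (including the trivial one) and $\alpha(G):=c(G)/|G|$. The commuting probability $\operatorname{cp}(G)$ is the probability that two elements of $G$ commute, that is, $\operatorname{cp}(G)=|S|/|G\times G|$ where $S$ is the set of pairs $(x,y)\in G\times G$ with $xy=yx$. The Fitting subgroup is the largest nilpotent normal subgroup of $G$. The first inequality is a consequence of a known theorem of Guralnick and Robinson. *)

(* Defs.v *)
From mathcomp Require Import all_boot all_order all_algebra all_fingroup all_solvable.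

Set Implicit Arguments.
Unset Strict Implicit.
Unset Printing Implicit Defensive.

Import Order.TTheory GRing.Theory Num.Theory.
Local Open Scope ring_scope.

Definition cyclic_subgroups (gT : finGroupType) (G : {group gT}) :
    {set {group gT}} :=
  [set H in subgroups G | cyclic H].

Definition alpha (gT : finGroupType) (G : {group gT}) : rat :=
  #|cyclic_subgroups G|%:R / #|G|%:R.

Definition commuting_pairs (gT : finGroupType) (G : {group gT}) :
    {set gT * gT} :=
  [set p in setX G G | (p.1 * p.2 == p.2 * p.1)%g].

Definition cp (gT : finGroupType) (G : {group gT}) : rat :=
  #|commuting_pairs G|%:R / #|setX G G|%:R.

(* Main.v *)
Require Import Defs.
From mathcomp Require Import all_boot all_order all_algebra all_fingroup all_solvable.
From mathcomp Require Import all_character.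
From mathcomp Require Import zify ring.

Set Implicit Arguments.
Unset Strict Implicit.
Unset Printing Implicit Defensive.

(** Write ncomm G for the number of commuting pairs of elements of G, so that
    cp(G) = ncomm G / #|G| ^ 2, and F for the Fitting subgroup of G. Both
    inequalities follow from cp(G) ^ 2 <= 1 / #|G : F|, because of

      (2 alpha(G) - 1) ^ 2 <= cp(G)   when 2 alpha(G) - 1 >= 0.

    For this, let i be the number of solutions of x ^+ 2 = 1 in G. A cyclic group
    of order at least 3 has two generators, so twice the number of cyclic
    subgroups is at most #|G| + i (leq_card_cyclic); and i ^ 2 <= ncomm G, since
    the ways of writing g as a product of two such solutions all lie over one
    coset of the centraliser of g (involutive_sqr_leq).

    The bound on cp(G) rests on the inequality cp(G) <= cp(N) * cp(G / N) for N
    normal in G (ncomm_quotient). It reduces the problem to the metanilpotent case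

      cp(M) <= 1 / #|M : F(M)|   if M / F(M) is nilpotent (metanilpotent_ncomm).

    Indeed, take N to be the second term of the Fitting series of G: induction on
    the order gives cp(G) * cp(G / F) <= 1 / #|G : F| (ncomm_two_step), and
    cp(G) <= cp(G / F).

    In the metanilpotent case, descend a chief series of F. For a chief factor
    V = X / Y and F <= L <= M, a nilpotent group of order prime to #|V| acts on V,
    and counting commuting pairs by cosets of V gives

      ncomm (L / Y) <= #|V| * sum over v in V of ncomm (L_v / X),

    with L_v the stabiliser of v in L (ncomm_lift). Iterating this bounds ncomm M
    by a sum of ncomm over intersections of point stabilisers in the nilpotent
    group M / F, one for each chief factor (chain_data). Such sums are controlled
    by the key result on modules, module_class_bound:

      sum over v in V of ncomm 'C_L[v] <= #|L| * #|V|

    for a nilpotent group L acting faithfully and coprimely on an elementary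
    abelian group V; equivalently, V L has at most #|V| conjugacy classes. The
    predicate kgood extends the inequality to unfaithful actions in a form that
    can be multiplied over several modules (kgood_meets). At the end of the chief
    series no kernel is left: the elements acting trivially on all the chief
    factors of F form, with F, a nilpotent normal subgroup.

    For module_class_bound, Maschke's theorem reduces to irreducible V. If all
    abelian normal subgroups of L are cyclic, then L or a subgroup of index 2 in L
    acts semiregularly (primitive_structure) and the sum can be estimated
    directly. Otherwise V is a product of p blocks permuted by L / N of prime
    order p (imprimitive_structure). Induction covers the commuting pairs in N.
    The others are related to an element y outside N, whose fixed points in V
    project injectively to one block, and are bounded by means of module_bounds,
    an estimate for the order of L and its number of orbits on V. *)

(** * Commuting pairs *)

Section CommutingPairs.
Local Open Scope group_scope.

Definition ncomm (gT : finGroupType) (A : {set gT}) : nat :=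
  \sum_(x in A) #|'C_A[x]|.

Lemma sum_mem (T : finType) (A B : {set T}) :
  (\sum_(x in A) (x \in B) = #|A :&: B|)%N.
Proof.
rewrite -sum1_card big_mkcond [RHS]big_mkcond; apply: eq_bigr => x _.
by rewrite in_setI; case: (x \in A); case: (x \in B).
Qed.

Lemma exchange_cent (gT : finGroupType) (A B : {set gT}) :
  \sum_(x in A) #|'C_B[x]| = \sum_(y in B) #|'C_A[y]|.
Proof.
transitivity (\sum_(x in A) \sum_(y in B | y \in 'C[x]) 1)%N.
  by apply: eq_bigr => x _; rewrite -sum1_card; apply: eq_bigl => y; rewrite in_setI.
rewrite (exchange_big_dep (mem B)) /=; last by move=> x y _ /andP[].
apply: eq_bigr => y By; rewrite -sum1_card; apply: eq_bigl => x.
by rewrite in_setI cent1C By.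
Qed.

(** Two elements of a fibre of f that both commute with x differ by an element of
    the kernel that commutes with x. *)
Lemma leq_cent_coset (gT rT : finGroupType) (D L : {group gT})
    (f : {morphism D >-> rT}) (x : gT) (b : rT) : L \subset D ->
  #|[set y in L | (f y == b) && (y \in 'C[x])]| <= #|'C_('ker_L f)[x]|.
Proof.
move=> sLD; set E := [set y in _ | _].
have [-> | [y0 Ey0]] := set_0Vmem E; first by rewrite cards0.
rewrite -(card_lcoset E y0^-1); apply/subset_leq_card/subsetP=> _ /lcosetP[y Ey ->].
move: Ey0 Ey; rewrite ![_ \in E]in_set => /and3P[Ly0 /eqP fy0 cy0] /and3P[Ly /eqP fy cy].
have Dy0 := subsetP sLD _ Ly0; have Dy := subsetP sLD _ Ly.
have Lz : y0^-1 * y \in L by rewrite groupM ?groupV.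
rewrite in_setI (groupM _ cy) ?groupV // andbT in_setI Lz.
apply/kerP; first exact: (subsetP sLD).
by rewrite morphM ?morphV ?groupV // fy fy0 mulVg.
Qed.

Definition fiber_pairs (gT rT : finGroupType) (f : gT -> rT) (L : {set gT}) a b :=
  \sum_(x in L | f x == a) #|[set y in L | (f y == b) && (y \in 'C[x])]|.

Lemma ncomm_fibers (gT rT : finGroupType) (D L : {group gT})
    (f : {morphism D >-> rT}) : L \subset D ->
  ncomm L = \sum_(a in f @* L) \sum_(b in f @* L) fiber_pairs f L a b.
Proof.
move=> sLD.
have fL x : x \in L -> f x \in f @* L.
  by move=> Lx; rewrite mem_morphim // (subsetP sLD).
rewrite /ncomm (partition_big f (mem (f @* L))) //=.
apply: eq_bigr => a _; rewrite [RHS]exchange_big /=.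
apply: eq_bigr => x /andP[Lx _].
rewrite -sum1_card (partition_big f (mem (f @* L))) /=; last first.
  by move=> y; rewrite in_setI => /andP[/fL].
apply: eq_bigr => b _; rewrite -sum1_card; apply: eq_bigl => y.
by rewrite in_setI [in RHS]in_set -andbA; congr (_ && _); rewrite andbC.
Qed.

Lemma fiber_pairs_eq0 (gT rT : finGroupType) (D L : {group gT})
    (f : {morphism D >-> rT}) a b : L \subset D -> b \notin 'C[a] ->
  fiber_pairs f L a b = 0.
Proof.
move=> sLD ncab; apply/eqP; rewrite sum_nat_eq0; apply/forall_inP=> x /andP[Lx /eqP fx].
apply/eqP/eq_card0=> y; rewrite in_set; apply: contraNF ncab.
case/and3P=> Ly /eqP fy cyx; rewrite -fx -fy.
apply/cent1P; rewrite /commute -!morphM ?(subsetP sLD) //.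
by rewrite (cent1P cyx).
Qed.

(** Each pair of cosets of the kernel contains at most as many commuting pairs
    as the kernel itself: an element x has at most as many centralisers in a
    coset as in the kernel, and this can be used on both sides in turn. *)
Lemma ncomm_morphim (gT rT : finGroupType) (D L : {group gT})
    (f : {morphism D >-> rT}) : L \subset D ->
  (ncomm L <= ncomm (f @* L) * ncomm ('ker_L f))%N.
Proof.
move=> sLD; set K := 'ker_L f.
have fib a b : (fiber_pairs f L a b <= (b \in 'C[a]) * ncomm K)%N.
  have [cab | ncab] := boolP (b \in 'C[a]); last by rewrite fiber_pairs_eq0.
  rewrite mul1n; apply: (@leq_trans (\sum_(x in L | f x == a) #|'C_K[x]|)).
    by apply: leq_sum => x _; apply: leq_cent_coset.
  pose Xa := [set x in L | f x == a].
  have ->: (\sum_(x in L | f x == a) #|'C_K[x]| = \sum_(x in Xa) #|'C_K[x]|)%N.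
    by apply: eq_bigl => x; rewrite inE.
  rewrite exchange_cent; apply: leq_sum => n _.
  apply: leq_trans (leq_cent_coset f n a sLD).
  apply/subset_leq_card/subsetP=> x.
  by rewrite in_setI ![_ \in [set _ in _ | _]]in_set -andbA.
rewrite (ncomm_fibers f sLD) big_distrl /=; apply: leq_sum => a La.
apply: leq_trans (leq_sum _ (fun b _ => fib a b)) _.
by rewrite -big_distrl /= sum_mem.
Qed.

Lemma ncomm_le (gT : finGroupType) (A : {group gT}) : (ncomm A <= #|A| ^ 2)%N.
Proof.
rewrite expnS expn1 /ncomm -sum_nat_const; apply: leq_sum => x _.
exact/subset_leq_card/subsetIl.
Qed.

Lemma ncomm_isog (gT rT : finGroupType) (A : {group gT}) (B : {group rT}) :
  A \isog B -> ncomm A = ncomm B.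
Proof.
have inj (aT bT : finGroupType) (G : {group aT}) (H : {group bT}) :
    G \isog H -> (ncomm G <= ncomm H)%N.
  case/isogP=> f injf <-; apply: leq_trans (ncomm_morphim f (subxx G)) _.
  rewrite ker_injm // setIg1 -[leqRHS]muln1 leq_mul2l.
  by rewrite (leq_trans (ncomm_le 1)) ?orbT // cards1.
by move=> isoAB; apply/eqP; rewrite eqn_leq !inj // isog_sym.
Qed.

Lemma ncomm_quotient (gT : finGroupType) (G N : {group gT}) :
  N <| G -> (ncomm G <= ncomm (G / N) * ncomm N)%N.
Proof.
case/andP=> sNG nNG; apply: leq_trans (ncomm_morphim (coset_morphism N) nNG) _.
by rewrite ker_coset (setIidPr sNG).
Qed.

Lemma ncomm_abelian (gT : finGroupType) (A : {group gT}) :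
  abelian A -> (ncomm A = #|A| ^ 2)%N.
Proof.
move=> cAA; rewrite expnS expn1 /ncomm -sum_nat_const; apply: eq_bigr => x Ax.
by apply/eq_card => y; rewrite in_setI; case Ay: (y \in A) => //=;
  apply/cent1P/(centsP cAA).
Qed.

Lemma leq_index_setI (gT : finGroupType) (L N A : {group gT}) :
  N \subset L -> A \subset L -> (#|A| <= #|L : N| * #|A :&: N|)%N.
Proof.
move=> sNL sAL; rewrite -(LagrangeI A N) mulnC leq_mul2r; apply/orP; right.
exact/subset_leq_card/imsetS.
Qed.

End CommutingPairs.

(** * Families of stabilisers *)

Section StabiliserFamilies.
Local Open Scope group_scope.
Variable hT : finGroupType.
Implicit Types (H K L : {group hT}) (Ss Ts : seq {group hT}).

(** Ss stands for the stabilisers of the points of a set on which H acts with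
    kernel K. When L meets K trivially, the inequality says that the subgroups
    L :&: X contain on average at most #|L| commuting pairs; the factors in
    L :&: K are those of the same statement for the faithful quotient of L.
    Asking this of every subgroup L of H makes the property pass to products
    of H-sets. *)
Definition kgood H Ss K := forall L, L \subset H ->
  ((\sum_(X <- Ss) ncomm (L :&: X)) * #|L :&: K|
     <= #|L| * ncomm (L :&: K) * size Ss)%N.

(** The analogue of kgood for the orders of the stabilisers, with the constant
    m / d in place of the size of the family. *)
Definition sgood d m H Ss K := forall L, L \subset H ->
  (d * \sum_(X <- Ss) #|L :&: X| <= m * #|L :&: K|)%N.

Definition ogood d m H K := forall L, L \subset H -> (d * #|L| <= m * #|L :&: K|)%N.

(** The stabilisers of the pairs of points, when Ss and Ts are the stabilisers
    of the points of two H-sets. *)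
Definition meets Ss Ts := [seq (X :&: Y)%G | X <- Ss, Y <- Ts].

(** The bound for Ts, used in L :&: X for each X in Ss, leaves a sum over Ss of
    the ncomm (L :&: M :&: X), to which the bound for Ss applies in L :&: M. *)
Lemma kgood_meets H Ss Ts K M :
  kgood H Ss K -> kgood H Ts M -> kgood H (meets Ss Ts) (K :&: M).
Proof.
move=> gS gT L sLH; pose LM := (L :&: M)%G; pose C := L :&: (K :&: M).
have eC : C = LM :&: K by rewrite /C /= (setIC K) setIA.
have sLM : LM \subset H by rewrite subIset ?sLH.
rewrite size_allpairs big_allpairs_dep /= -/C.
have main : ((\sum_(X <- Ss) \sum_(Y <- Ts) ncomm (L :&: (X :&: Y))) * #|LM|
    <= #|L| * size Ts * \sum_(X <- Ss) ncomm (LM :&: X))%N.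
  rewrite big_distrl big_distrr /=; apply: leq_sum => X _.
  pose LS := (L :&: X)%G.
  have sLS : LS \subset H by rewrite subIset ?sLH.
  have eM : LS :&: M = LM :&: X by rewrite /= setIAC.
  have pos : (0 < #|LM :&: X|)%N by apply: cardG_gt0.
  rewrite -(leq_pmul2r pos).
  have idx : (#|LS| * #|LM| <= #|L| * #|LM :&: X|)%N.
    have eI : LM :&: LS = LM :&: X.
      by apply/setP=> z; rewrite !in_setI; case: (z \in L).
    have:= leq_index_setI (subsetIl L X) (subsetIl L M).
    by rewrite -/LS -/LM eI -(Lagrange (subsetIl L X)) -mulnA leq_pmul2l.
  have := gT LS sLS; rewrite eM => gTS.
  under eq_bigr do rewrite setIA.
  rewrite mulnAC; apply: leq_trans (leq_mul gTS (leqnn _)) _.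
  have := leq_mul idx (leqnn (ncomm (LM :&: X) * size Ts)); rewrite /=; nia.
have gSM := gS LM sLM; rewrite -eC in gSM.
have posM : (0 < #|LM|)%N by apply: cardG_gt0.
rewrite -(leq_pmul2r posM).
rewrite mulnAC; apply: leq_trans (leq_mul main (leqnn _)) _.
have := leq_mul (leqnn (#|L| * size Ts)%N) gSM; rewrite /=; nia.
Qed.

Lemma sgood_meets c d m n H Ss Ts K M :
  sgood c m H Ss K -> sgood d n H Ts M ->
  sgood (c * d)%N (m * n)%N H (meets Ss Ts) (K :&: M).
Proof.
move=> gS gT L sLH; pose LM := (L :&: M)%G.
have sLM : LM \subset H by rewrite subIset ?sLH.
have eC : L :&: (K :&: M) = LM :&: K by rewrite /= (setIC K) setIA.
rewrite big_allpairs_dep /= eC -mulnA.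
apply: (@leq_trans (c * \sum_(X <- Ss) n * #|LM :&: X|)%N).
  rewrite leq_mul2l big_distrr /=; apply/orP; right.
  apply: leq_sum => X _; pose LS := (L :&: X)%G.
  have sLS : LS \subset H by rewrite subIset ?sLH.
  have := gT LS sLS; rewrite /= [L :&: X :&: M]setIAC; apply: leq_trans.
  by under eq_bigr do rewrite setIA.
by rewrite -big_distrr /= mulnCA mulnAC [leqRHS]mulnC leq_mul2l (gS LM) ?orbT.
Qed.

Lemma ogood_meets c d m n H K M :
  ogood c m H K -> ogood d n H M -> ogood (c * d)%N (m * n)%N H (K :&: M).
Proof.
move=> gK gM L sLH; pose LK := (L :&: K)%G.
have sLK : LK \subset H by rewrite subIset ?sLH.
rewrite setIA mulnAC; apply: leq_trans (leq_mul (gK L sLH) (leqnn d)) _.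
by rewrite mulnAC -!mulnA leq_mul2l (gM LK) ?orbT.
Qed.

End StabiliserFamilies.

Section Index.
Local Open Scope group_scope.
Variable gT : finGroupType.

(** For y outside N, at most #|L : N| times as many elements of A as of A :&: N
    commute with y; the pairs (x, y) with x in N and y outside account for the
    additional 1 in the factor. *)
Lemma ncomm_index (L N A : {group gT}) : N \subset L -> A \subset L ->
  (ncomm A <= ncomm (A :&: N)
     + #|L : N|.+1 * \sum_(y in A :\: N) #|'C_(A :&: N)[y]|)%N.
Proof.
move=> sNL sAL; set M := A :&: N; set p := #|L : N|.
rewrite {1}/ncomm (big_setID N) /= -/M.
have out : (\sum_(y in A :\: N) #|'C_A[y]|
             <= p * \sum_(y in A :\: N) #|'C_M[y]|)%N.
  rewrite big_distrr /=; apply: leq_sum => y _.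
  have:= leq_index_setI sNL (subset_trans (subsetIl A 'C[y]) sAL).
  by rewrite /M (setIAC A).
have inn : (\sum_(y in M) #|'C_A[y]| = ncomm M + \sum_(y in A :\: N) #|'C_M[y]|)%N.
  rewrite -(exchange_cent M) /ncomm -big_split /=; apply: eq_bigr => y _.
  by rewrite -(cardsID N) setIAC setIDAC.
by rewrite inn -addnA leq_add2l mulSn leq_add2l.
Qed.

End Index.

(** * Coprime nilpotent groups of automorphisms *)

Section Modules.
Local Open Scope group_scope.

(** The orbit of v under L contributes #|L| times the class number of 'C_L[v], so
    when V is abelian, normalised by L and of order prime to that of L, this is
    #|L| times the number of conjugacy classes of V L. *)
Definition fixcomm (gT : finGroupType) (V L : {set gT}) : nat :=
  \sum_(v in V) ncomm 'C_L[v].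

Definition fixsum (gT : finGroupType) (V L : {set gT}) : nat :=
  \sum_(v in V) #|'C_L[v]|.

Definition stabs (gT : finGroupType) (V : {group gT}) : seq {group gT} :=
  [seq 'C[v]%G | v <- enum V].

(** L acts by conjugation on V, a module over the field of q elements in which V
    and L have coprime orders; the action need not be faithful. *)
Definition nilmod q (gT : finGroupType) (V L : {group gT}) :=
  [&& q.-abelem V, q^'.-group L, L \subset 'N(V) & nilpotent L].

Lemma size_stabs (gT : finGroupType) (V : {group gT}) : size (stabs V) = #|V|.
Proof. by rewrite size_map cardE. Qed.

Lemma sum_stabs (gT : finGroupType) (V : {group gT}) (F : {set gT} -> nat) :
  \sum_(X <- stabs V) F X = \sum_(v in V) F 'C[v].
Proof. by rewrite big_map big_enum. Qed.

Lemma nilmodS q (gT : finGroupType) (V L U M : {group gT}) :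
  nilmod q V L -> U \subset V -> M \subset L -> M \subset 'N(U) -> nilmod q U M.
Proof.
case/and4P=> abV q'L _ nilL sUV sML nUM.
by rewrite /nilmod (abelemS sUV) // (pgroupS sML) // nUM (nilpotentS sML).
Qed.

Lemma nilmod_coprime q (gT : finGroupType) (V L : {group gT}) :
  nilmod q V L -> coprime #|V| #|L|.
Proof. by case/and4P=> /abelem_pgroup qV q'L _ _; apply: pnat_coprime qV q'L. Qed.

(** V meets the kernel C of the action trivially by coprimality, so passing to the
    quotient by C keeps V and its stabilisers and makes the action faithful. *)
Lemma nilmod_quotient q (gT : finGroupType) (V L : {group gT})
    (C := 'C_L(V)%G) : nilmod q V L ->
  [/\ nilmod q (V / C)%G (L / C)%G, 'C_(L / C)(V / C) = 1,
      {in V &, injective (coset C)}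
    & {in V, forall v, 'C_(L / C)[coset C v] = 'C_L[v] / C}].
Proof.
move=> mVL; have [abV q'L nVL nilL] := and4P mVL.
have nCV : V \subset 'N(C) by rewrite cents_norm // centsC subsetIr.
have nCL : L \subset 'N(C) by rewrite /C /= normsI ?normG ?norms_cent.
have tiVC : V :&: C = 1.
  by apply: coprime_TIg; rewrite (coprimegS (subsetIl L _)) // (nilmod_coprime mVL).
have injC : {in V &, injective (coset C)}.
  move=> u v Vu Vv /= eq_uv; have Nu := subsetP nCV _ Vu.
  have Nv := subsetP nCV _ Vv.
  apply/eqP; rewrite eq_mulgV1 -in_set1 -[[set 1]]tiVC inE groupM ?groupV //=.
  by rewrite coset_idr ?groupM ?groupV // morphM ?morphV ?groupV //= eq_uv mulgV.
have cent1 v : v \in V -> 'C_(L / C)[coset C v] = 'C_L[v] / C.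
  move=> Vv; have Nv := subsetP nCV _ Vv.
  apply/setP=> w; apply/setIP/morphimP=> [[] | [x Nx /setIP[Lx cvx] ->]].
    case/morphimP=> x Nx Lx -> /cent1P cvx; exists x => //.
    rewrite inE Lx /=; apply/cent1P/commgP; rewrite -in_set1 -[[set 1]]tiVC inE.
    apply/andP; split.
      by rewrite commgEr groupM // memJ_norm ?groupV // (subsetP nVL).
    by rewrite coset_idr ?groupR // morphR //=; apply/eqP/commgP.
  split; first exact: mem_quotient.
  by apply/cent1P; rewrite /commute -!morphM // (cent1P cvx).
split=> //.
  by rewrite /nilmod quotient_abelem // quotient_pgroup // quotient_norms // quotient_nil.
apply/trivgP/subsetP=> w /setIP[Lw /centP cw].
case/morphimP: Lw cw => x Nx Lx -> cx.
suff Cx : x \in C by rewrite /= coset_id.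
rewrite inE Lx; apply/centP => v Vv; have Nv := subsetP nCV _ Vv.
have : coset C x \in 'C_(L / C)[coset C v].
  rewrite inE mem_quotient //; apply/cent1P.
  exact: cx _ (mem_quotient C Vv).
rewrite cent1 // => /morphimP[y Ny /setIP[Ly cvy] /= eq_xy].
have Cyx : y^-1 * x \in C.
  by rewrite coset_idr ?groupM ?groupV // morphM ?morphV ?groupV //= eq_xy mulVg.
rewrite -(mulKVg y x); apply/commute_sym/commuteM; first by apply/cent1P; rewrite cent1C.
by case/setIP: Cyx => _ /centP/(_ _ Vv)/commute_sym.
Qed.

Lemma big_quotient_mod q (gT : finGroupType) (V L : {group gT})
    (C := 'C_L(V)%G) (F : {set coset_of C} -> nat) : nilmod q V L ->
  \sum_(w in V / C) F 'C_(L / C)[w] = \sum_(v in V) F ('C_L[v] / C).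
Proof.
move=> mVL; have [_ _ injC centC] := nilmod_quotient mVL.
have nCV : V \subset 'N(C) by rewrite cents_norm // centsC subsetIr.
have -> : V / C = coset C @: V by rewrite /quotient morphimEsub.
by rewrite big_imset //=; apply: eq_bigr => v Vv; rewrite centC.
Qed.

Lemma card_quotient_mod q (gT : finGroupType) (V L : {group gT}) :
  nilmod q V L -> #|V / 'C_L(V)| = #|V|.
Proof.
move=> mVL; have [_ _ injC _] := nilmod_quotient mVL.
by rewrite /quotient morphimEsub ?cents_norm 1?centsC ?subsetIr // card_in_imset.
Qed.

(** A bound for faithful actions suffices: M acts on V as its quotient by 'C_M(V),
    and the stabilisers contain this kernel, so ncomm_quotient lifts the bound. *)
Lemma kgood_stabs q (gT : finGroupType) (V L : {group gT}) :
    nilmod q V L ->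
    (forall M : {group gT}, M \subset L ->
      fixcomm (V / 'C_M(V)) (M / 'C_M(V)) <= #|M / 'C_M(V)| * #|V|) ->
  kgood L (stabs V) 'C(V)%G.
Proof.
move=> mVL bd M sML; set C := 'C_M(V)%G.
have mVM : nilmod q V M.
  by apply: (nilmodS mVL) => //; case/and4P: mVL => _ _ nVL _; apply: subset_trans nVL.
have nsC v : v \in V -> C <| 'C_M[v].
  move=> Vv; rewrite /normal setIS /=; last by rewrite -cent_set1 centS ?sub1set.
  by rewrite subIset // normsI ?normG ?norms_cent //; case/and4P: mVM.
rewrite size_stabs (sum_stabs V (fun X => ncomm (M :&: X))) /= -/C.
have {}bd := bd M sML; rewrite /fixcomm (big_quotient_mod (@ncomm _) mVM) in bd.
have le1 : \sum_(v in V) ncomm 'C_M[v]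
    <= (\sum_(v in V) ncomm ('C_M[v] / C)) * ncomm C.
  by rewrite big_distrl; apply: leq_sum => v Vv; apply: ncomm_quotient (nsC v Vv).
have idx : (#|M / C| * #|C| = #|M|)%N.
  rewrite card_quotient ?normsI ?normG ?norms_cent //; last by case/and4P: mVM.
  by rewrite mulnC Lagrange ?subsetIl.
rewrite -idx; have := leq_mul le1 (leqnn #|C|).
by have := leq_mul bd (leqnn (ncomm C * #|C|)%N); rewrite /=; nia.
Qed.

Lemma sgood_stabs q d m (gT : finGroupType) (V L : {group gT}) :
    nilmod q V L ->
    (forall M : {group gT}, M \subset L ->
      (d * fixsum (V / 'C_M(V)) (M / 'C_M(V)) <= m)%N) ->
  sgood d m L (stabs V) 'C(V)%G.
Proof.
move=> mVL bd M sML; set C := 'C_M(V)%G.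
have mVM : nilmod q V M.
  by apply: (nilmodS mVL) => //; case/and4P: mVL => _ _ nVL _; apply: subset_trans nVL.
have nsC v : v \in V -> C <| 'C_M[v].
  move=> Vv; rewrite /normal setIS /=; last by rewrite -cent_set1 centS ?sub1set.
  by rewrite subIset // normsI ?normG ?norms_cent //; case/and4P: mVM.
rewrite (sum_stabs V (fun X => #|M :&: X|)) /= -/C.
have {}bd := bd M sML.
rewrite /fixsum (big_quotient_mod (fun A => #|pred_of_set A|) mVM) in bd.
apply: (@leq_trans (d * \sum_(v in V) #|'C_M[v] / C| * #|C|)%N).
  rewrite leq_mul2l; apply/orP; right; apply: leq_sum => v Vv.
  have [sC nC] := andP (nsC v Vv).
  by rewrite card_quotient // mulnC Lagrange.
by rewrite -big_distrl mulnA leq_mul2r bd orbT.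
Qed.

Lemma ogood_mod q d m (gT : finGroupType) (V L : {group gT}) :
    nilmod q V L ->
    (forall M : {group gT}, M \subset L -> (d * #|M / 'C_M(V)| <= m)%N) ->
  ogood d m L 'C(V)%G.
Proof.
move=> mVL bd M sML; have [_ _ nVL _] := and4P mVL.
have nCM : M \subset 'N('C_M(V)).
  by rewrite normsI ?normG ?norms_cent ?(subset_trans sML).
have := bd M sML; rewrite card_quotient // => le_m.
rewrite -(Lagrange (subsetIl M 'C(V))) mulnCA mulnC leq_mul2r.
by rewrite le_m orbT.
Qed.

(** A direct decomposition of V reduces sums over V to sums over the pairwise
    intersections of the two stabiliser families. *)
Lemma sum_meets (gT : finGroupType) (V U R L : {group gT})
    (F : {set gT} -> nat) : U \x R = V -> L \subset 'N(U) -> L \subset 'N(R) ->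
  \sum_(X <- meets (stabs U) (stabs R)) F (L :&: X) = \sum_(v in V) F 'C_L[v].
Proof.
move=> dV nUL nRL; have [_ eV cUR tiUR] := dprodP dV.
rewrite big_allpairs_dep /=.
rewrite (sum_stabs U (fun X => \sum_(Y <- stabs R) F (L :&: (X :&: Y)))).
under eq_bigr => u _ do rewrite (sum_stabs R (fun Y => F (L :&: ('C[u] :&: Y)))).
rewrite pair_big_dep /=.
have eVE : [set p.1 * p.2 | p in setX U R] = V.
  rewrite -eV; apply/setP=> w; apply/imsetP/mulsgP=> [[[u r] /setXP[]]|[u r]].
    by exists u r.
  by move=> Uu Rr ->; exists (u, r) => //; apply/setXP.
have injm : {in setX U R &, injective (fun p : gT * gT => p.1 * p.2)}.
  move=> [u r] [u' r'] /setXP[/= Uu Rr] /setXP[/= Uu' Rr'] /= eq_ur.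
  congr (_, _); first by rewrite -(divgrMid tiUR Uu Rr) eq_ur divgrMid.
  by rewrite -(remgrMid tiUR Uu Rr) eq_ur remgrMid.
rewrite -[in RHS]eVE big_imset //=; apply: eq_big => [[u r]|[u r] /andP[Uu Rr]] /=.
  by rewrite in_setX.
congr (F _); apply/setP=> x; rewrite !in_setI; case Lx: (x \in L) => //=.
have nUx := subsetP nUL x Lx; have nRx := subsetP nRL x Lx.
apply/andP/idP => [[cu cr] | /cent1P cur].
  by rewrite cent1C groupM // cent1C.
have eur : u ^ x * r ^ x = u * r by rewrite -conjMg /conjg -cur mulKg.
have Uux : u ^ x \in U by rewrite memJ_norm.
have Rrx : r ^ x \in R by rewrite memJ_norm.
split; rewrite cent1C; apply/cent1P/commgP/conjg_fixP.
  by rewrite -(divgrMid tiUR Uux Rrx) eur divgrMid.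
by rewrite -(remgrMid tiUR Uux Rrx) eur remgrMid.
Qed.

Section Dprod.
Variables (gT : finGroupType) (V U R L : {group gT}).
Hypotheses (dV : U \x R = V) (nUL : L \subset 'N(U)) (nRL : L \subset 'N(R)).

Lemma cent_dprodE : 'C(U) :&: 'C(R) = 'C(V).
Proof. by have [_ <- _ _] := dprodP dV; rewrite centM. Qed.

Lemma kgood_dprod : kgood L (stabs U) 'C(U)%G -> kgood L (stabs R) 'C(R)%G ->
  kgood L (stabs V) 'C(V)%G.
Proof.
move=> gU gR M sML; have := kgood_meets gU gR sML.
rewrite size_allpairs !size_stabs (dprod_card dV) /= cent_dprodE.
rewrite (@sum_meets _ V U R M) ?(subset_trans sML) //.
by rewrite (sum_stabs V (fun X => ncomm (M :&: X))).
Qed.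

Lemma sgood_dprod c d m n :
  sgood c m L (stabs U) 'C(U)%G -> sgood d n L (stabs R) 'C(R)%G ->
  sgood (c * d)%N (m * n)%N L (stabs V) 'C(V)%G.
Proof.
move=> gU gR M sML; have := sgood_meets gU gR sML.
rewrite /= cent_dprodE.
rewrite (@sum_meets _ V U R M (fun X => #|X|)) ?(subset_trans sML) //.
by rewrite (sum_stabs V (fun X => #|M :&: X|)).
Qed.

Lemma ogood_dprod c d m n : ogood c m L 'C(U)%G -> ogood d n L 'C(R)%G ->
  ogood (c * d)%N (m * n)%N L 'C(V)%G.
Proof.
by move=> gU gR M sML; have := ogood_meets gU gR sML; rewrite /= cent_dprodE.
Qed.

End Dprod.

End Modules.

(** * Invariant subgroups of coprime modules *)

Section Irreducible.
Local Open Scope group_scope.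
Variable gT : finGroupType.
Implicit Types V L U A B D N R W : {group gT}.

(** Maschke's theorem: by Gaschutz, U has a complement in V L because it has one
    in V, and this complement meets V in an invariant complement. *)
Lemma nilmod_splits q V L U : nilmod q V L -> U \subset V -> L \subset 'N(U) ->
  exists R : {group gT}, U \x R = V /\ L \subset 'N(R).
Proof.
move=> mVL sUV nUL; have [abV q'L nVL nilL] := and4P mVL.
have cVV := abelem_abelian abV.
pose G := (V <*> L)%G; have eG : G = V * L :> {set gT} by rewrite /= norm_joinEr.
have sVG : V \subset G by apply: joing_subl.
have nsUG : U <| G.
  by rewrite /normal (subset_trans sUV) //= join_subG nUL sub_abelian_norm.
have idx : #|G : V| %| #|L|.
  rewrite -divgS // eG TI_cardMg ?(coprime_TIg (nilmod_coprime mVL)) //.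
  by rewrite mulKn ?cardG_gt0.
have co : coprime #|U| #|G : V|.
  apply: coprime_dvdr idx _; apply: coprime_dvdl (cardSg sUV) _.
  exact: nilmod_coprime mVL.
have : [splits G, over U].
  by rewrite (Gaschutz_split nsUG sUV) ?(abelianS sUV) //; apply: abelem_splits abV sUV.
case/splitsP=> K /complP[tiUK eUK].
have sKG : K \subset G by rewrite -eUK mulG_subr.
have nR : G \subset 'N(K :&: V).
  rewrite eG mul_subG //; first by rewrite sub_abelian_norm ?subsetIr.
  have: G \subset 'N(K :&: V).
    rewrite -eUK mul_subG //; last first.
      by rewrite normsI ?normG // (subset_trans sKG) //= join_subG normG.
    by rewrite (subset_trans sUV) // sub_abelian_norm // subsetIr.
  exact: subset_trans (joing_subr _ _).
exists (K :&: V)%G; split; last exact: subset_trans (joing_subr _ _) nR.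
rewrite dprodE /=.
- by rewrite group_modl // eUK; apply/setIidPr.
- by rewrite (centSS (subsetIr _ _) sUV).
by rewrite setIA tiUK (setIidPl _) // sub1G.
Qed.

Lemma coprime_cent_dprod V D : abelian V -> D \subset 'N(V) ->
  coprime #|V| #|D| -> 'C_V(D) \x [~: V, D] = V.
Proof.
move=> cVV nVD co; have sRV : [~: V, D] \subset V by rewrite commg_subl.
rewrite dprodE; last first.
- rewrite setIC -[RHS](coprime_abel_cent_TI nVD co cVV); apply/setP=> x.
  by rewrite !inE; case Rx: (x \in [~: V, D]) => //=; rewrite (subsetP sRV).
- by rewrite (centSS sRV (subsetIl _ _)).
apply/eqP; rewrite eqEsubset mul_subG ?subsetIl //=.
have nRV : V \subset 'N([~: V, D]) by rewrite sub_abelian_norm.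
have nRD : D \subset 'N([~: V, D]) by rewrite commg_normr.
rewrite centC ?(centSS (subsetIl _ _) sRV) // -quotientSK // coprime_quotient_cent ?abelian_sol //.
by rewrite subsetI subxx /= quotient_cents2r.
Qed.

(** B acts faithfully on each minimal B-invariant subgroup U of V, and by Schur's
    lemma an abelian group with a faithful irreducible module is cyclic. *)
Lemma semireg_abelian_cyclic q V B : q.-abelem V -> B \subset 'N(V) ->
  V :!=: 1 -> abelian B -> {in B^#, forall b, 'C_V[b] = 1} -> cyclic B.
Proof.
move=> abV nVB ntV cBB sreg.
have [U minU sUV] : {U : {group gT} | minnormal U B & U \subset V}.
  by apply: mingroup_exists; rewrite ntV.
have [/andP[ntU nUB] _] := mingroupP minU.
have abU := abelemS sUV abV.
have qpr : prime q.
  by have [] := pgroup_pdiv (abelem_pgroup abU) ntU.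
have fU : 'C_B(U) = 1.
  apply/trivgP/subsetP=> b /setIP[Bb cUb]; apply: contraR ntU => nb1.
  rewrite -subG1 -(sreg b); last by rewrite !inE -in_set1 nb1.
  by rewrite subsetI sUV sub_cent1.
have /(mx_faithful_irr_abelian_cyclic (abelem_mx_faithful abU ntU nUB fU)) irr
  := elimT (abelem_mx_irrP abU ntU nUB) minU.
exact: irr.
Qed.

Lemma minnormal_or V L U : minnormal V L ->
  U \subset V -> L \subset 'N(U) -> U :=: 1 \/ U :=: V.
Proof.
move=> /mingroupP[_ minV] sUV nUL; have [U1 | ntU] := eqVneq (U : {set gT}) 1.
  by left.
by right; apply: minV => //; rewrite ntU.
Qed.

(** The fixed points of a normal cyclic subgroup form an L-invariant subgroup. *)
Lemma normal_cent1_trivial V L (x : gT) : minnormal V L -> 'C_L(V) = 1 ->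
  x \in L -> x != 1 -> <[x]> <| L -> 'C_V[x] = 1.
Proof.
move=> minV fV Lx nx1 /andP[_ nxL]; have [/andP[_ nVL] _] := mingroupP minV.
have nC : L \subset 'N('C_V[x]) by rewrite normsI // -cent_cycle norms_cent.
case: (minnormal_or (U := 'C_V[x]%G) minV (subsetIl _ _) nC) => // eV.
case/eqP: nx1; apply/set1P; rewrite -[[set 1]]fV inE Lx /= -sub_cent1.
by have := subsetIr V 'C[x]; rewrite (eV : 'C_V[x] = V).
Qed.

End Irreducible.

(** * Noncyclic abelian normal subgroups *)

Section Imprimitive.
Local Open Scope group_scope.
Variable gT : finGroupType.
Implicit Types V L U A B D N R W : {group gT}.

(** The p'-part of a nilpotent group centralises its p-part. *)
Lemma nil_pcore_normal_trans p L B : nilpotent L -> B <| 'O_p(L) -> B <| L.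
Proof.
move=> nilL nsBP; have sBP := normal_sub nsBP.
rewrite /normal (subset_trans sBP (pcore_sub _ _)) /=.
have [_ eL cPP' _] := dprodP (nilpotent_pcoreC p nilL); rewrite -{1}eL.
apply: mul_subG; first exact: normal_norm.
by rewrite cents_norm // (subset_trans cPP') ?centS.
Qed.

Lemma nil_normal_p2 A L : nilpotent L -> A <| L -> abelian A -> ~~ cyclic A ->
  exists p B, [/\ prime p, B <| L, p.-abelem B & #|B| = (p ^ 2)%N].
Proof.
move=> nilL nsAL cAA ncA.
have [p pr ncP] : exists2 p, prime p & ~~ cyclic 'O_p(A).
  have: ~~ Zgroup A by apply: contra ncA => /nil_Zgroup_cyclic-> //; apply: abelian_nil.
  rewrite negb_forall_in => /exists_inP[P /SylowP[p pr sylP] ncP]; exists p => //.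
  by rewrite -(nilpotent_Hall_pcore (abelian_nil cAA) sylP).
have pP : p.-group 'O_p(A) := pcore_pgroup p A.
have cPP : abelian 'O_p(A) := abelianS (pcore_sub p A) cAA.
have nsEL : 'Ohm_1('O_p(A)) <| L by do 2!apply: gFnormal_trans.
have le2 : 2 <= logn p #|'Ohm_1('O_p(A))|.
  by rewrite -(p_rank_abelian p cPP) -(rank_pgroup pP) ltnNge -abelian_rank1_cyclic.
have pE : p.-group 'Ohm_1('O_p(A)) := pgroupS (Ohm_sub 1 _) pP.
have sEP : 'Ohm_1('O_p(A)) \subset 'O_p(L) by apply: pcore_max.
have nsEP : 'Ohm_1('O_p(A)) <| 'O_p(L) by apply: normalS nsEL; rewrite ?pcore_sub.
have [B [sBE nsBP cardB]] := normal_pgroup (pcore_pgroup p L) nsEP le2.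
exists p, B; split=> //; last exact: abelemS sBE (Ohm1_abelem pP cPP).
exact: nil_pcore_normal_trans nsBP.
Qed.

(** V is the direct product of p blocks, the conjugates of W under the powers of
    any y in L outside N, and R is the product of the blocks other than W. That V
    is not larger than this product is expressed by the absence of nontrivial
    y-invariant subgroups in R. When p = 2, some e central in N acts without fixed
    points on W and trivially on the other block. *)
Definition imprimitive_data (V L : {group gT}) p (N W R : {group gT}) : Prop :=
  [/\ [/\ prime p, N <| L & #|L : N| = p],
      [/\ W :!=: 1, W \x R = V, N \subset 'N(W) & N \subset 'N(R)],
      {in L :\: N, forall y, W :^ y \subset R},
      (forall U, U \subset R -> {in L :\: N, forall y, y \in 'N(U) -> U :=: 1})
    & p < #|W| /\ (p = 2 -> exists2 e, e \in 'Z(N) & 'C_W[e] = 1 /\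
        {in L :\: N, forall y, e ^ y^-1 \in 'C(W)})].

(** L has a normal subgroup B of type (p, p). It is not semiregular on V, because
    semireg_abelian_cyclic would make it cyclic, so some D = <[b]> of order p in B
    has nontrivial fixed points W in V. A central b would have no fixed point
    by normal_cent1_trivial, so b is not central; its class lies in B, whence
    N = 'C_L(b) = 'C_L(B) has index p. Any two distinct conjugates of D
    generate B, which has no fixed points, so D acts without fixed points on the
    conjugates W :^ y != W, which therefore lie in R = [~: V, D]. When p = 2 the element e
    is a conjugate of b outside D. *)
Lemma imprimitive_structure q V L A : nilmod q V L -> minnormal V L ->
    'C_L(V) = 1 -> A <| L -> abelian A -> ~~ cyclic A ->
  exists p N W R, imprimitive_data V L p N W R.
Proof.
move=> mVL minV fV nsAL cAA ncA; have [abV q'L nVL nilL] := and4P mVL.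
have [/andP[ntV _] _] := mingroupP minV.
have cVV := abelem_abelian abV.
have [p [B [pr nsBL abB cardB]]] := nil_normal_p2 nilL nsAL cAA ncA.
have [sBL nBL] := andP nsBL; have cBB := abelem_abelian abB.
have pB := abelem_pgroup abB.
have [b Bb1 ntW] : exists2 b, b \in B^# & 'C_V[b] != 1.
  apply/exists_inP; rewrite -negb_forall_in.
  apply: contraL (isT : true) => /forall_inP sreg.
  have : cyclic B.
    apply: (semireg_abelian_cyclic abV (subset_trans sBL nVL) ntV cBB) => b Bb.
    exact/eqP/sreg.
  by rewrite (abelem_cyclic abB) cardB pfactorK.
have [nb1 Bb] := setD1P Bb1; have Lb := subsetP sBL b Bb.
have ncb : b \notin 'C(L).
  apply: contra ntW => cLb; apply/eqP.
  apply: (normal_cent1_trivial minV fV Lb nb1).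
  rewrite /normal cycle_subG Lb cents_norm //= centsC cycle_subG //.
pose D := <[b]>%G; pose N := 'C_L(B)%G.
have oD : #|D| = p by apply: abelem_order_p abB Bb nb1.
have sDB : D \subset B by rewrite cycle_subG.
have dvdL A1 : p.-group A1 -> A1 \subset L -> A1 :!=: 1 -> p <= #|A1|.
  move=> pA1 _ ntA1; have [_ dv _] := pgroup_pdiv pA1 ntA1.
  by apply: dvdn_leq dv; apply: cardG_gt0.
have genB A1 A2 : A1 \subset B -> A2 \subset B -> A1 :!=: 1 -> A2 :!=: 1 ->
    A1 :&: A2 = 1 -> A1 * A2 = B.
  move=> sA1 sA2 nt1 nt2 ti; apply/eqP; rewrite eqEcard mul_subG //=.
  rewrite TI_cardMg // cardB expnS expn1 leq_mul // dvdL //;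
    by rewrite ?(pgroupS _ pB) ?(subset_trans _ sBL).
have ntD : D :!=: 1 by rewrite cycle_eq1.
(* B is generated by b and by a central subgroup of order p. *)
have eN : N :=: 'C_L[b].
  apply/eqP; rewrite eqEsubset /= -cent_cycle setIS ?centS //=.
  have ntZ : B :&: 'Z(L) != 1 by apply: meet_center_nil => //; apply/trivgPn; exists b.
  have tiZ : (B :&: 'Z(L)) :&: D = 1.
    rewrite setIC prime_TIg ?oD //; apply: contra ncb.
    by rewrite cycle_subG => /setIP[_ /setIP[]].
  have <- : (B :&: 'Z(L)) * D = B.
    exact: (genB (B :&: 'Z(L))%G D (subsetIl _ _) sDB ntZ ntD tiZ).
  rewrite subsetI subsetIl /= centM subsetI subsetIr andbT.
  by rewrite subIset // centsC (subset_trans (subsetIr B _)) ?subsetIr.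
have nsNL : N <| L by rewrite /normal subsetIl normsI ?normG ?norms_cent.
have [sNL nNL] := andP nsNL.
have pLN : p.-group (L / N).
  have [_ eL cPP _] := dprodP (nilpotent_pcoreC p nilL).
  have sP'N : 'O_p^'(L) \subset N.
    rewrite subsetI pcore_sub (subset_trans cPP) // centS //.
    exact: pcore_max.
  have nNP : 'O_p(L) \subset 'N(N) by rewrite (subset_trans (pcore_sub _ _)).
  rewrite -eL quotientMl // (quotientS1 sP'N) mulg1.
  by rewrite quotient_pgroup ?pcore_pgroup.
have idxN : #|L : N| = p.
  have: #|L : N| = (p ^ logn p #|L : N|)%N.
    by rewrite -card_quotient //; apply: card_pgroup.
  have: #|L : N| < p ^ 2.
    rewrite eN index_cent1 -cardB; apply: proper_card; rewrite properE.
    apply/andP; split.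
      by apply/subsetP=> _ /imsetP[x Lx ->]; rewrite memJ_norm ?(subsetP nBL).
    apply/subsetPn; exists 1; rewrite ?group1 //; apply: contra nb1.
    by rewrite class_sym => /imsetP[x _ ->]; rewrite conj1g.
  have: #|L : N| != 1%N.
    rewrite indexg_eq1 eN; apply: contra ncb => sLC.
    by rewrite -sub_cent1 (subset_trans sLC) ?subsetIr.
  move=> n1 lt2 eqp; move: n1 lt2; rewrite eqp.
  case: (logn p _) => [|[|k]] //; rewrite ?expn1 // => _.
  by rewrite ltn_exp2l ?prime_gt1.
have maxN : maximal N L by apply: (p_index_maximal sNL); rewrite idxN.
have genL y : y \in L :\: N -> N * <[y]> = L.
  case/setDP=> Ly nNy; apply: mulg_normal_maximal => //; first by rewrite cycle_subG.
  by rewrite cycle_subG.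
have cND : N \subset 'C(D) by rewrite eN cent_cycle subsetIr.
have nDy y : y \in L :\: N -> y \notin 'N(D).
  move=> Ny; apply: contra ncb => nDy.
  have nDL : L \subset 'N(D) by rewrite -(genL y Ny) mul_subG ?cycle_subG // cents_norm.
  have nsDL : D <| L by rewrite /normal (subset_trans sDB).
  have := meet_center_nil nilL nsDL ntD; apply: contraR => nZ.
  apply/eqP; apply: prime_TIg; rewrite ?oD // cycle_subG.
  by apply: contra nZ => /setIP[].
have sNG : N \subset 'N(V) := subset_trans sNL nVL.
have sBN : B \subset N by rewrite subsetI sBL.
have nVB := subset_trans sBN sNG; have nVD := subset_trans sDB nVB.
have sDyB y : y \in L -> D :^ y \subset B.
  by move=> Ly; rewrite -(normsP nBL y Ly) conjSg.
have genDy y : y \in L :\: N -> D * (D :^ y) = B.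
  move=> Ny; have Ly : y \in L by case/setDP: Ny.
  apply: (genB D (D :^ y)%G) => //; rewrite ?sDyB ?conjsg_eq1 //.
  rewrite prime_TIg ?oD //; apply: contra (nDy y Ny) => sDDy.
  by apply/normP/esym/eqP; rewrite eqEcard sDDy cardJg leqnn.
have tVB : 'C_V(B) = 1.
  have nC : L \subset 'N('C_V(B)) by rewrite normsI // norms_cent.
  case: (minnormal_or (U := 'C_V(B)%G) minV (subsetIl _ _) nC) => // eV.
  have: B \subset 'C_L(V).
    rewrite subsetI sBL centsC; have := subsetIr V 'C(B).
    by rewrite (eV : 'C_V(B) = V).
  by rewrite fV => /subsetP/(_ b Bb)/set1P b1; case/eqP: nb1.
pose W := 'C_V(D)%G; pose R := [~: V, D]%G.
have coVD : coprime #|V| #|D|.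
  exact: coprimegS (subset_trans sDB sBL) (nilmod_coprime mVL).
have dV : W \x R = V by apply: coprime_cent_dprod.
have tiDy y : y \in L :\: N -> W :&: 'C(D :^ y) = 1.
  by move=> Ny; apply/trivgP; rewrite -tVB -(genDy y Ny) centM setIA.
have WJ y : y \in L -> W :^ y = 'C_V(D :^ y).
  by move=> Ly; rewrite conjIg centJ (normsP nVL).
(* D acts on W :^ y without fixed points, so W :^ y = [~: W :^ y, D]. *)
have moveW y : y \in L :\: N -> W :^ y \subset R.
  move=> Ny; have Ly : y \in L by case/setDP: Ny.
  have sWV : 'C_V(D :^ y) \subset V by apply: subsetIl.
  have nWD : D \subset 'N('C_V(D :^ y)).
    rewrite normsI // norms_cent // cents_norm // (subset_trans sDB) //.
    by rewrite (centsS (sDyB y Ly)).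
  have [_ eWy _ _] := dprodP (coprime_cent_dprod (abelianS sWV cVV) nWD (coprimeSg sWV coVD)).
  rewrite WJ // -eWy.
  have -> : 'C_('C_V(D :^ y))(D) = 1 by rewrite setIAC; apply: tiDy.
  by rewrite mul1g commSg.
have nRN : N \subset 'N(R) by rewrite normsR // cents_norm.
have nWN : N \subset 'N(W) by rewrite normsI // norms_cent // cents_norm.
have ntWW : W :!=: 1 by rewrite /= cent_cycle.
have [y0 Ny0] : exists y0, y0 \in L :\: N.
  by apply/set0Pn; rewrite setD_eq0; case/maxgroupP: maxN => /andP[].
have Ly0 : y0 \in L by case/setDP: Ny0.
exists p, N, W, R; split=> //; last split.
(* The L-core of R contains U and, being invariant and smaller than V, is trivial. *)
- move=> U sUR y Ny nUy; have sRV : R \subset V by rewrite commg_subl.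
  have sUg : U \subset gcore R L.
    apply/bigcapsP=> x; rewrite -(genL y Ny) => /mulsgP[n z Nn yz ->].
    have nUz : z \in 'N(U) by apply: subsetP yz; rewrite cycle_subG.
    by rewrite conjsgM (normsP nRN) // -(normP nUz) conjSg.
  have sgV : gcore R L \subset V by rewrite (subset_trans (gcore_sub _ _)).
  case: (minnormal_or (U := [group of gcore R L]) minV sgV (gcore_norm _ _)) => /= eg.
    by apply/trivgP; rewrite -eg.
  have [_ _ _ tiWR] := dprodP dV; case/eqP: ntWW; rewrite -tiWR.
  apply/esym/setIidPl; rewrite (subset_trans _ (gcore_sub R L)) // eg.
  exact: subsetIl.
(* A conjugate of D of order p acts semiregularly on W, so p divides #|W| - 1. *)
- have nWDy : D :^ y0 \subset 'N(W) by rewrite (subset_trans (sDyB _ Ly0)) ?(subset_trans sBN).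
  have sreg : semiregular W (D :^ y0).
    move=> x /setD1P[ntx Dx]; rewrite -cent_cycle -[RHS](tiDy y0 Ny0).
    congr (_ :&: 'C(_)); apply/eqP; rewrite eqEcard cycle_subG Dx cardJg oD /=.
    have Bx : x \in B := subsetP (sDyB y0 Ly0) x Dx.
    by rewrite -[#|<[x]>|]/#[x] (abelem_order_p abB Bx).
  have := regular_norm_dvd_pred nWDy sreg; rewrite cardJg oD.
  have := cardG_gt1 W; rewrite ntWW; case: #|W| => [|[|w]] //= _.
  by move/dvdn_leq => /(_ isT).
- move=> p2; exists (b ^ y0); last split.
  + have By0 : b ^ y0 \in B by rewrite memJ_norm // (subsetP nBL).
    rewrite inE (subsetP sBN) //=.
    by apply: subsetP By0; rewrite centsC subsetIr.
  + by rewrite -cent_cycle cycleJ; apply: tiDy.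
  + move=> y Ny; have Ly : y \in L by case/setDP: Ny.
    have : y0 * y^-1 \in N.
      by rewrite -mem_rcoset (rcoset_index2 sNL) // ?idxN.
    rewrite eN => /setIP[_ /cent1P cb].
    have -> : (b ^ y0) ^ y^-1 = b.
      by rewrite -conjgM; apply/conjg_fixP/commgP.
    by have := subsetIr V 'C(D); rewrite centsC cycle_subG; apply.
Qed.

End Imprimitive.

(** * Cyclic abelian normal subgroups *)

Section Primitive.
Local Open Scope group_scope.
Variable gT : finGroupType.
Implicit Types V L U A B S X O : {group gT}.

(** The remaining classes are the dihedral and semidihedral groups. *)
Lemma extremal2_nonquaternion S : extremal2 S -> extremal_class S != Quaternion ->
    15 < #|S| ->
  exists X, [/\ X <| S, cyclic X, #|S : X| = 2, #|'Z(S)| = 2 & 2.-group S].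
Proof.
move=> ext nQ lt15.
suff [n [x [y [genS oZ]]]] : exists n x y,
    extremal_generators S 2 n (x, y) /\ #|'Z(S)| = 2.
  have [pS maxX nsX _ _] := extremal_generators_facts (isT : prime 2) genS.
  exists <[x]>%G; split=> //; first exact: cycle_cyclic.
  exact: p_maximal_index pS maxX.
have lt3 n : #|S| = (2 ^ n)%N -> 3 < n.
  by move=> oS; move: lt15; rewrite oS -[16]/(2 ^ 4)%N leq_exp2l.
move: ext nQ; rewrite /extremal2; case E: (extremal_class S) => // _ _.
- have [n n1 isoS] := (dihedral_classP S).1 E.
  have [[x y] genS _] := generators_2dihedral n1 isoS.
  have n3 : 3 < n by apply: lt3; case: genS.
  have [_ _ _ _] := dihedral2_structure n1 genS isoS.
  by case: eqP n3 => [-> // | _ _ [_ oZ _ _ _]]; exists n, x, y.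
have [n n3 isoS] := (semidihedral_classP S).1 E.
have [[x y] genS [oy _]] := generators_semidihedral n3 isoS.
have [_ _ [_ oZ _ _] _ _] := semidihedral_structure n3 genS isoS oy.
by exists n, x, y.
Qed.

(** The case of a dihedral or semidihedral Sylow 2-subgroup: A is generated by a
    cyclic maximal subgroup of it and by the odd part of L. Elements outside A
    centralise at most 2 elements of the 2-part of A, which has order at least 8. *)
Definition index2_data V L A :=
  [/\ A <| L, abelian A, #|L : A| = 2, semiregular V A & 7 < #|A| /\
     {in L :\: A, forall y, 4 * #|'C_A[y]| <= #|A|}].

(** By the structure of p-groups whose abelian normal subgroups are cyclic, the
    Sylow subgroups of L are cyclic for p odd, and cyclic, quaternion, dihedral or
    semidihedral for p = 2. In the cyclic and quaternion cases each element of
    prime order spans a characteristic subgroup, hence has no fixed point in V,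
    and L is semiregular. In the others a cyclic subgroup of index 2 in the Sylow
    2-subgroup and the odd part of L generate the subgroup A of index2_data. *)
Lemma primitive_structure q V L : nilmod q V L -> minnormal V L ->
    'C_L(V) = 1 -> (forall A, A <| L -> abelian A -> cyclic A) ->
  semiregular V L \/ exists A, index2_data V L A.
Proof.
move=> mVL minV fV cycA; have [abV q'L nVL nilL] := and4P mVL.
have cycP (p : nat) X : X <| 'O_p(L) -> abelian X -> cyclic X.
  by move=> nsX; apply: cycA; apply: nil_pcore_normal_trans nsX.
have n1P (p : nat) := normal_rank1_structure (pcore_pgroup p L) (cycP p).
have sregA A : A <| L -> abelian A -> semiregular V A.
  move=> nsA cAA x /setD1P[nx1 Ax].
  apply: (normal_cent1_trivial minV fV (subsetP (normal_sub nsA) x Ax) nx1).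
  apply: (char_normal_trans _ nsA).
  by rewrite (sub_cyclic_char <[x]>%G (cycA A nsA cAA)) cycle_subG.
have cyc_odd (p : nat) : p != 2 -> cyclic 'O_p(L).
  by move=> n2; case: (n1P p) => // /and3P[/eqP p2]; rewrite p2 in n2.
set S := 'O_2(L)%G.
have [easy | ] := boolP (cyclic S || (extremal_class S == Quaternion)).
  left=> x /setD1P[nx1 Lx].
  pose p := pdiv #[x]; have ox : 1 < #[x] by rewrite order_gt1.
  have pr : prime p by apply: pdiv_prime.
  (* It is enough to treat a power z of prime order of x: it fixes what x fixes. *)
  pose z := x ^+ (#[x] %/ p).
  have oz : #[z] = p.
    have dv : p %| #[x] := pdiv_dvd _.
    rewrite orderXdiv ?dvdn_div //; have := order_gt0 x; rewrite -(divnK dv).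
    by case: (_ %/ p) => // m _; rewrite mulnK ?prime_gt0 // mulKn.
  have Lz : z \in L by rewrite groupX.
  apply/trivgP; apply: (@subset_trans _ _ (gval 'C_V[z]%G)).
    rewrite setIS //; apply/subsetP=> v /cent1P cvx.
    by apply/cent1P; first [exact: commuteX | apply/commute_sym/commuteX/commute_sym].
  rewrite /= subG1; apply/eqP.
  have Pz : z \in 'O_p(L).
    rewrite (mem_normal_Hall (nilpotent_pcore_Hall p nilL)) ?pcore_normal //.
    by rewrite /p_elt oz pnat_id.
  have ntP : 'O_p(L) != 1.
    by apply/trivgPn; exists z => //; rewrite -order_gt1 oz prime_gt1.
  have Oz : z \in 'Ohm_1('O_p(L)).
    by rewrite Ohm1Eprime mem_gen // inE Pz oz.
  have oO : #|'Ohm_1('O_p(L))| = p.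
    apply/(prime_Ohm1P (pcore_pgroup p L) ntP).
    have [p2 | /cyc_odd-> //] := eqVneq p 2.
    by rewrite p2.
  have eO : <[z]> = 'Ohm_1('O_p(L)).
    by apply/eqP; rewrite eqEcard cycle_subG Oz oO -[#|_|]/#[z] oz /=.
  apply: (normal_cent1_trivial minV fV) => //; last first.
    by rewrite eO; do 2!apply: gFnormal_trans.
  by rewrite -order_gt1 oz prime_gt1.
rewrite negb_or => /andP[ncS nQ]; right.
have /and3P[_ ext big] : [&& 2 == 2, extremal2 S & (15 < #|S|) || (S \isog 'Q_8)].
  by case: (n1P 2) ncS => // ->.
have lt15 : 15 < #|S|.
  case/orP: big => //; rewrite (_ : 8 = 2 ^ 3)%N // => isoQ; case/eqP: nQ.
  by apply/(quaternion_classP S); exists 3.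
have [X [nsXS cycX idxX oZ pS]] := extremal2_nonquaternion ext nQ lt15.
have nsXL := nil_pcore_normal_trans nilL nsXS.
pose O := 'O_2^'(L)%G; have nsOL : O <| L by apply: pcore_normal.
have dL : S \x O = L := nilpotent_pcoreC 2 nilL.
have [_ eL cSO tiSO] := dprodP dL.
have cycO : cyclic O.
  apply: nil_Zgroup_cyclic; last exact: nilpotentS (normal_sub nsOL) nilL.
  apply/forall_inP=> P /SylowP[p pr sylP].
  have [P1 | ntP] := eqVneq (P : {set gT}) 1; first by rewrite P1 cyclic1.
  have pP := pHall_pgroup sylP; have sPO := pHall_sub sylP.
  have p2 : p != 2.
    have [_ dv _] := pgroup_pdiv pP ntP.
    have := pgroupP (pgroupS sPO (pcore_pgroup _ _)) p pr dv.
    by rewrite !inE.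
  apply: cyclicS (cyc_odd p p2).
  have nilO : nilpotent O := nilpotentS (normal_sub nsOL) nilL.
  rewrite (nilpotent_Hall_pcore nilO sylP); apply: pcore_max; first exact: pcore_pgroup.
  by do 2!apply: gFnormal_trans.
pose A := (X <*> O)%G.
have cXO : O \subset 'C(X) by apply: subset_trans cSO (centS (normal_sub nsXS)).
have eA : A = X * O :> {set gT} by rewrite /= cent_joinEr.
have tiXO : X :&: O = 1.
  by apply/trivgP; rewrite -tiSO setSI // normal_sub.
have cardA : #|A| = (#|X| * #|O|)%N by rewrite eA TI_cardMg.
have cardL : #|L| = (#|S| * #|O|)%N by rewrite -(dprod_card dL).
have cardS : #|S| = (#|X| * 2)%N by rewrite -(Lagrange (normal_sub nsXS)) idxX.
have nsA : A <| L by rewrite normalY.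
have cAA : abelian A by rewrite abelianY (cyclic_abelian cycX) (cyclic_abelian cycO).
have idxA : #|L : A| = 2.
  rewrite -divgS ?normal_sub // cardL cardA cardS mulnAC mulKn //.
  by rewrite muln_gt0 !cardG_gt0.
exists A; split=> //; first exact: sregA.
have o8 : 7 < #|X|.
  by move: lt15; rewrite cardS -[X in X <= _]/(8 * 2)%N leq_pmul2r.
split; first by rewrite cardA (leq_trans o8) // leq_pmulr ?cardG_gt0.
move=> y Ay; have [Ly nAy] := setDP Ay.
have sCZ : 'C_A[y] \subset 'Z(L).
  rewrite subsetI (subset_trans (subsetIl _ _) (normal_sub nsA)) /=.
  have maxA : maximal A L by apply: p_index_maximal; rewrite ?normal_sub ?idxA.
  have eAy : A * <[y]> = L by rewrite (mulg_normal_maximal nsA maxA) ?cycle_subG.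
  rewrite -[X in 'C(X)]eAy centM subsetI cent_cycle subsetIr andbT.
  exact: subset_trans (subsetIl _ _) cAA.
have [_ eZ _ tiZ] := dprodP (center_dprod dL).
have cardZ : #|'Z(L)| <= 2 * #|O|.
  rewrite -eZ (TI_cardMg tiZ) oZ leq_mul2l subset_leq_card //.
  exact: subsetIl.
rewrite cardA (leq_trans (leq_mul (leqnn 4) (leq_trans (subset_leq_card sCZ) cardZ))) //.
by rewrite mulnA leq_mul2r o8 orbT.
Qed.

End Primitive.

(** * Counting fixed points *)

Section Counting.
Local Open Scope group_scope.
Variable gT : finGroupType.
Implicit Types V L U A B N R W X : {group gT}.

(** The four situations in which the bounds on fixsum and fixcomm are proved, by
    induction in the first and the last. *)
Lemma nilmod_cases q V L : nilmod q V L -> 'C_L(V) = 1 -> V :!=: 1 ->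
  [\/ exists U R, [/\ U \x R = V, U :!=: 1, R :!=: 1, L \subset 'N(U) & L \subset 'N(R)],
      semiregular V L,
      exists A, index2_data V L A
    | exists p N W R, imprimitive_data V L p N W R].
Proof.
move=> mVL fV ntV; have [abV q'L nVL nilL] := and4P mVL.
have [U minU sUV] : {U : {group gT} | minnormal U L & U \subset V}.
  by apply: mingroup_exists; rewrite ntV.
have [/andP[ntU nUL] _] := mingroupP minU.
have [R [dV nRL]] := nilmod_splits mVL sUV nUL.
have [eUV | nUV] := eqVneq (U : {set gT}) V; last first.
  apply: Or41; exists U, R; split=> //; apply: contraNneq nUV => R1.
  by rewrite -dV R1 dprodg1.
have minV : minnormal V L by rewrite -eUV.
have [cycA | ncA] := boolP [forall (A : {group gT} | (A <| L) && abelian A), cyclic A].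
  have cyc A : A <| L -> abelian A -> cyclic A.
    by move=> nsA cAA; apply: (forall_inP cycA); rewrite nsA.
  by have [sreg | ix2] := primitive_structure mVL minV fV cyc; [apply: Or42 | apply: Or43].
rewrite negb_forall_in in ncA; have [A /andP[nsA cAA] nc] := exists_inP ncA.
exact/Or44/(imprimitive_structure mVL minV fV nsA cAA nc).
Qed.

Lemma fixsumC V L : fixsum V L = \sum_(x in L) #|'C_V[x]|.
Proof. exact: exchange_cent. Qed.

Lemma fixsum_setD V L A : A \subset L ->
  fixsum V L = (fixsum V A + \sum_(y in L :\: A) #|'C_V[y]|)%N.
Proof.
by move=> sAL; rewrite !fixsumC (big_setID A) /= (setIidPr sAL).
Qed.

Lemma semiregular_stab V L v : semiregular V L -> v \in V -> v != 1 -> 'C_L[v] = 1.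
Proof.
move=> sreg Vv nv1; apply: (semiregular_sym sreg).
by rewrite !inE nv1.
Qed.

Lemma semiregular_card V L : semiregular V L -> L \subset 'N(V) -> V :!=: 1 ->
  #|L| < #|V|.
Proof.
move=> sreg nVL; rewrite -cardG_gt1 => lt1V.
have /dvdn_leq : #|L| %| #|V|.-1 := regular_norm_dvd_pred nVL sreg.
by case: #|V| lt1V => [|[|n]] //= _; apply.
Qed.

Lemma fixsum_semiregular V L : semiregular V L ->
  (fixsum V L = #|L| + #|V|.-1)%N.
Proof.
move=> sreg; rewrite /fixsum (big_setD1 1) //= cent11T setIT; congr (_ + _)%N.
rewrite (eq_bigr (fun=> 1%N)) => [|v /setD1P[nv1 Vv]].
  by rewrite sum_nat_const muln1 (cardsD1 1 V) group1.
by rewrite (semiregular_stab sreg) ?cards1.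
Qed.

(** Outside a semiregular subgroup A of index 2, a nontrivial v has at most one
    element fixing it, since its stabiliser meets A trivially. *)
Lemma sum_cent_index2 V L A : A \subset L -> #|L : A| = 2 -> semiregular V A ->
  (\sum_(y in L :\: A) #|'C_V[y]| <= #|A| + #|V|.-1)%N.
Proof.
move=> sAL idx sreg; rewrite exchange_cent (big_setD1 1) //= cent11T setIT.
have cardLA : #|L :\: A| = #|A|.
  by rewrite cardsD (setIidPr sAL) -(Lagrange sAL) idx muln2 -addnn addnK.
rewrite cardLA leq_add2l.
apply: (@leq_trans (\sum_(v in V :\ 1%g) 1)%N); last first.
  by rewrite sum1_card (cardsD1 1 V) group1.
apply: leq_sum => v /setD1P[nv1 Vv]; rewrite setIDAC.
have := leq_index_setI sAL (subsetIl L 'C[v]); rewrite idx.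
have -> : 'C_L[v] :&: A = 1.
  by rewrite setIAC (setIidPr sAL) (semiregular_stab sreg).
rewrite cards1 muln1 => le2; rewrite cardsD leq_subLR (leq_trans le2) //.
by rewrite addn1 ltnS cardG_gt0.
Qed.

End Counting.

Section ImprimitiveCounting.
Local Open Scope group_scope.
Variables (gT : finGroupType) (q : nat) (V L : {group gT}) (p : nat).
Variables (N W R : {group gT}).
Hypothesis mVL : nilmod q V L.
Hypothesis data : imprimitive_data V L p N W R.

Let pr : prime p. Proof. by case: data => [[]]. Qed.
Let nsNL : N <| L. Proof. by case: data => [[]]. Qed.
Let sNL : N \subset L. Proof. exact: normal_sub. Qed.
Let idxN : #|L : N| = p. Proof. by case: data => [[]]. Qed.
Let ntW : W :!=: 1. Proof. by case: data => _ []. Qed.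
Let dV : W \x R = V. Proof. by case: data => _ []. Qed.
Let nWN : N \subset 'N(W). Proof. by case: data => _ []. Qed.
Let nRN : N \subset 'N(R). Proof. by case: data => _ []. Qed.
Let moveW y : y \in L :\: N -> W :^ y \subset R.
Proof. by case: data => _ _ H _ _ /H. Qed.
Let core (U : {group gT}) y :
  U \subset R -> y \in L :\: N -> y \in 'N(U) -> U :=: 1.
Proof. by case: data => _ _ _ H _ sUR Ny; apply: H. Qed.

Let sWV : W \subset V. Proof. by have [_ <- _ _] := dprodP dV; apply: mulG_subl. Qed.
Let sRV : R \subset V. Proof. by have [_ <- _ _] := dprodP dV; apply: mulG_subr. Qed.
Let tiWR : W :&: R = 1. Proof. by have [] := dprodP dV. Qed.
Let cRW : R \subset 'C(W). Proof. by have [_ _ cRW _] := dprodP dV. Qed.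
Let nVL : L \subset 'N(V). Proof. by case/and4P: mVL. Qed.

Lemma imprim_card_out : #|L :\: N| = (p.-1 * #|N|)%N.
Proof.
rewrite cardsD (setIidPr sNL) -(Lagrange sNL) idxN -{2}(mul1n #|N|) mulnC.
by rewrite -mulnBl subn1.
Qed.

Lemma imprim_exp y : y \in L -> y ^+ p \in N.
Proof.
move=> Ly; have Ny := subsetP (normal_norm nsNL) y Ly.
apply: coset_idr; rewrite ?groupX // morphX //= -idxN -card_quotient ?normal_norm //.
by rewrite expg_cardG // mem_quotient.
Qed.

Lemma imprim_exp_out y i : y \in L :\: N -> 0 < i < p -> y ^+ i \in L :\: N.
Proof.
case/setDP=> Ly nNy /andP[i0 ip]; have Ny := subsetP (normal_norm nsNL) y Ly.
apply/setDP; split; first exact: groupX.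
apply/negP=> Nyi.
have ntq : coset N y != 1.
  by apply: contra nNy => /eqP; apply: coset_idr.
have oq : #[coset N y] = p.
  apply/(prime_nt_dvdP pr); first by rewrite order_eq1.
  by rewrite -idxN -card_quotient ?normal_norm // order_dvdG ?mem_quotient.
have : p %| i by rewrite -oq order_dvdn -morphX //= coset_id.
by move/(dvdn_leq i0); rewrite leqNgt ip.
Qed.

(** f projects V onto the block W along R. It commutes with the action of N, and it
    is injective on the fixed points of y because two of them with the same
    component differ by a fixed point of y in R, of which there is only one. *)
Lemma imprim_component : exists f : gT -> gT,
  [/\ {in V, forall v, f v \in W},
      {in L :\: N, forall y, {in 'C_V[y] &, injective f}},
      {in L :\: N, forall y, {in 'C_V[y], forall v, f v \in 'C[y ^+ p]}}
    & {in N & V, forall x v, x \in 'C[v] -> x \in 'C[f v]}].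
Proof.
have eV : W * R = V by have [] := dprodP dV.
exists (divgr W R).
have fW v : v \in V -> divgr W R v \in W by move=> Vv; rewrite mem_divgr ?eV.
have rR v : v \in V -> remgr W R v \in R by move=> Vv; rewrite mem_remgr ?eV.
have cen x v : x \in N -> v \in V -> x \in 'C[v] -> x \in 'C[divgr W R v].
  move=> Nx Vv; rewrite !(cent1C x) => /cent1P cvx.
  apply/cent1P/commgP/conjg_fixP.
  have evx : v ^ x = v by apply/conjg_fixP/commgP.
  have Wx : divgr W R v ^ x \in W by rewrite memJ_norm ?fW ?(subsetP nWN).
  have Rx : remgr W R v ^ x \in R by rewrite memJ_norm ?rR ?(subsetP nRN).
  by rewrite -(divgrMid tiWR Wx Rx) -conjMg -divgr_eq evx.
split=> //.
- move=> y Ny u v /setIP[Vu cyu] /setIP[Vv cyv] eq_uv.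
  apply/eqP; rewrite eq_mulVg1 -in_set1.
  pose U := <[u^-1 * v]>%G.
  have sUR : U \subset R.
    rewrite cycle_subG (divgr_eq W R u) (divgr_eq W R v) eq_uv invMg mulgA mulgKV.
    by rewrite groupM ?groupV ?rR.
  have nUy : y \in 'N(U).
    by apply: (subsetP (cent_sub _)); rewrite cent_cycle cent1C groupM ?groupV.
  by have U1 := core sUR Ny nUy; rewrite -[[set 1]]U1 cycle_id.
- move=> y Ny v /setIP[Vv cyv]; rewrite cent1C; apply: cen => //.
    by case/setDP: Ny => Ly _; apply: imprim_exp.
  by rewrite groupX // cent1C.
Qed.

Lemma leq_cent_imprim y : y \in L :\: N -> #|'C_V[y]| <= #|'C_W[y ^+ p]|.
Proof.
move=> Ny; have [f [fW finj ffix _]] := imprim_component.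
rewrite -(card_in_imset (finj y Ny)); apply/subset_leq_card/subsetP=> _ /imsetP[v Cv ->].
by rewrite inE fW ?ffix //; case/setIP: Cv.
Qed.

(** The group K moves only the first block, and y carries that block into the
    others, so K acts only once in the p-th power of a product k * y. *)
Lemma imprim_expM k y u i : k \in 'C_N(R) -> y \in L :\: N -> u \in W ->
  0 < i <= p -> u ^ ((k * y) ^+ i) = u ^ (k * y ^+ i).
Proof.
case/setIP=> Nk cRk Ny Wu; elim: i => // [[|i]] IHi; first by rewrite !expg1.
case/andP=> _ lt_ip; rewrite expgSr conjgM IHi ?(ltnW lt_ip) //.
rewrite [in RHS]expgSr [in RHS]mulgA [RHS]conjgM [LHS]conjgM; congr (_ ^ y).
have Ruk : u ^ (k * y ^+ i.+1) \in R.
  apply: (subsetP (moveW (@imprim_exp_out y i.+1 Ny lt_ip))).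
  by rewrite conjgM memJ_conjg memJ_norm // (subsetP nWN).
by apply/conjg_fixP/commgP/esym/(centP cRk).
Qed.

(** The group K = 'C_N(R) moves only W. For y outside N, the elements k * y with k
    in K act on W through their p-th powers as k * y ^+ p, so the pairs (k, u) with
    u fixed by this product are at most as many as those with u fixed by k: for
    given u, the possible k lie in one coset of the stabiliser of u in K. Averaging
    over y gives the bound. *)
Lemma sum_cent_imprim :
  ((\sum_(y in L :\: N) #|'C_V[y]|) * #|'C_N(R)|
    <= #|L :\: N| * fixsum W 'C_N(R))%N.
Proof.
set K := 'C_N(R).
have sub y : y \in L :\: N -> (\sum_(k in K) #|'C_V[k * y]| <= fixsum W K)%N.
  move=> Ny; have [Ly nNy] := setDP Ny.
  have Nky k : k \in K -> k * y \in L :\: N.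
    case/setIP=> Nk _; have Lk := subsetP sNL k Nk.
    by apply/setDP; rewrite !groupMl.
  pose fx (k u : gT) := u ^ (k * y ^+ p) == u.
  apply: (@leq_trans (\sum_(k in K) #|[set u in W | fx k u]|)).
    apply: leq_sum => k Kk; apply: leq_trans (leq_cent_imprim (Nky k Kk)) _.
    apply/subset_leq_card/subsetP=> u /setIP[Wu].
    rewrite in_set Wu cent1C /fx => /cent1P cu /=.
    rewrite -(imprim_expM Kk Ny Wu) ?prime_gt0 ?leqnn //.
    by apply/eqP/conjg_fixP/commgP.
  have -> : (\sum_(k in K) #|[set u in W | fx k u]|
      = \sum_(u in W) #|[set k in K | fx k u]|)%N.
    transitivity (\sum_(k in K) \sum_(u in W | fx k u) 1)%N.
      by apply: eq_bigr => k _; rewrite -sum1_card; apply: eq_bigl => u; rewrite inE.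
    rewrite (exchange_big_dep (mem W)) /=; last by move=> k u _ /andP[].
    apply: eq_bigr => u Wu; rewrite -sum1_card; apply: eq_bigl => k.
    by rewrite in_set Wu.
  apply: leq_sum => u Wu; set E := [set k in K | _].
  have [-> | [k0 Ek0]] := set_0Vmem E; first by rewrite cards0.
  rewrite -(card_rcoset E k0^-1).
  apply/subset_leq_card/subsetP=> _ /rcosetP[k Ek ->].
  move: Ek0 Ek; rewrite ![_ \in E]in_set /fx => /andP[Kk0 /eqP e0] /andP[Kk /eqP e].
  rewrite inE groupM ?groupV //= cent1C; apply/cent1P/commgP/conjg_fixP.
  have euk : u ^ k = u ^ k0 by apply: (conjg_inj (y ^+ p)); rewrite -!conjgM e e0.
  by rewrite conjgM euk conjgK.
(* Left translation by k permutes the complement of N, so the sum on the left is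
   counted #|K| times by the double sum over y and k. *)
rewrite -(sum_nat_const _ (fixsum W K)) mulnC -sum_nat_const.
rewrite [X in X <= _](_ : _ = \sum_(y in L :\: N) \sum_(k in K) #|'C_V[k * y]|)%N.
  exact: leq_sum.
rewrite [RHS]exchange_big; apply: eq_bigr => k /setIP[Nk _] /=.
rewrite [RHS](reindex_inj (mulgI k^-1)) /=; apply: eq_big => y; last by rewrite mulKVg.
have Lk := subsetP sNL k Nk.
by rewrite !in_setD (groupMl y (groupVr Nk)) (groupMl y (groupVr Lk)).
Qed.

(** The product of the blocks W :^ y ^+ i for j <= i < p, written as the common
    kernel of the projections onto the first j blocks, so that N visibly acts on it. *)
Definition tail y j := (V :&: \bigcap_(i < j) (R :^ (y ^+ i)))%G.

Lemma tail0 y : tail y 0 :=: V.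
Proof. by rewrite /= big_ord0 setIT. Qed.

Lemma tail1 y : tail y 1 :=: R.
Proof. by rewrite /= big_ord_recl big_ord0 setIT conjsg1; apply/setIidPr. Qed.

Lemma tailS y j : tail y j.+1 = tail y j :&: R :^ (y ^+ j) :> {set gT}.
Proof. by rewrite /= big_ord_recr /= setIA. Qed.

(** The intersection of all the conjugates of R is invariant under y. *)
Lemma tail_end y : y \in L :\: N -> tail y p :=: 1.
Proof.
move=> Ny; have [Ly _] := setDP Ny.
apply: (core _ Ny).
  apply/subsetP=> t /setIP[_ /bigcapP tR].
  by have := tR (Ordinal (prime_gt0 pr)) isT; rewrite /= conjsg1.
rewrite inE; apply/subsetP=> _ /imsetP[t /setIP[Vt /bigcapP tR] ->].
rewrite inE memJ_norm ?(subsetP nVL) // Vt /=.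
apply/bigcapP=> [[[|i] lt_ip] _] /=; last first.
  by rewrite expgSr conjsgM memJ_conjg; apply: (tR (Ordinal (ltnW lt_ip)) isT).
have lt_p1p : p.-1 < p by rewrite prednK ?prime_gt0.
have := tR (Ordinal lt_p1p) isT.
rewrite /= -(memJ_conjg _ y) -conjsgM -expgSr prednK ?prime_gt0 //.
by rewrite conjsg1 (normsP nRN) // imprim_exp.
Qed.

Lemma norm_block y j : y \in L :\: N -> N \subset 'N(W :^ (y ^+ j)).
Proof.
case/setDP=> Ly _; have nNy := subsetP (normal_norm nsNL) _ (groupX j Ly).
by rewrite normJ -(normP nNy) conjSg.
Qed.

Lemma norm_tail y j : y \in L :\: N -> N \subset 'N(tail y j).
Proof.
case/setDP=> Ly _; apply: normsI; first exact: subset_trans nVL.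
apply: norms_bigcap; apply/bigcapsP => i _.
have nNy := subsetP (normal_norm nsNL) _ (groupX i Ly).
by rewrite normJ -(normP nNy) conjSg.
Qed.

Lemma tail_dprod y j : y \in L :\: N -> j < p ->
  W :^ (y ^+ j) \x tail y j.+1 = tail y j.
Proof.
move=> Ny lt_jp; have [Ly _] := setDP Ny.
have := dprodJ W R (y ^+ j); rewrite dV.
have -> : V :^ (y ^+ j) = V by rewrite (normsP nVL) ?groupX.
case/esym/dprodP=> _ eV cWR tiJ.
have sWT : W :^ (y ^+ j) \subset tail y j.
  rewrite subsetI -{1}eV mulG_subl; apply/bigcapsP=> [[i lt_ij]] _ /=.
  rewrite -(subnK (ltnW lt_ij)) expgD conjsgM conjSg.
  apply/moveW/imprim_exp_out => //.
  by rewrite subn_gt0 lt_ij (leq_ltn_trans (leq_subr _ _)).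
rewrite tailS dprodE.
- have := group_modl (R :^ (y ^+ j)) sWT; rewrite eV [in LHS]setIC => ->.
  exact/setIidPr/subsetIl.
- exact: subset_trans (subsetIr _ _) cWR.
apply/trivgP; rewrite -tiJ; apply: setIS; exact: subsetIr.
Qed.

Lemma card_tail y j : y \in L :\: N -> j <= p -> (#|tail y (p - j)| = #|W| ^ j)%N.
Proof.
move=> Ny; elim: j => [|j IHj] lt_jp.
  by rewrite subn0 (tail_end Ny) cards1.
have lt_p : p - j.+1 < p by rewrite ltn_subrL (prime_gt0 pr).
rewrite -(dprod_card (tail_dprod Ny lt_p)) cardJg subnSK //.
by rewrite IHj ?(ltnW lt_jp) // expnS.
Qed.

Lemma imprim_cardV : (#|V| = #|W| ^ p)%N.
Proof.
have [y Ny] : exists y, y \in L :\: N.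
  apply/set0Pn; rewrite setD_eq0; apply/negP=> sLN.
  have := prime_gt1 pr; rewrite -idxN.
  by move: sLN; rewrite -indexg_eq1 => /eqP->.
by rewrite -(card_tail Ny (leqnn p)) subnn (tail0 y).
Qed.

Lemma sgood_tail d m y : y \in L :\: N ->
    (forall i, i < p -> sgood d m N (stabs (W :^ (y ^+ i))%G) 'C(W :^ (y ^+ i))%G) ->
  forall j, j <= p ->
  sgood (d ^ j)%N (m ^ j)%N N (stabs (tail y (p - j))) 'C(tail y (p - j))%G.
Proof.
move=> Ny gW; elim=> [_ M sMN|j IHj lt_jp].
  rewrite (sum_stabs _ (fun X => #|M :&: X|)) subn0 /= (tail_end Ny).
  by rewrite big_set1 cent11T cent1T !setIT !mul1n.
have lt_p : p - j.+1 < p by rewrite ltn_subrL (prime_gt0 pr).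
rewrite !expnS; apply: (sgood_dprod (tail_dprod Ny lt_p)); first exact: norm_block.
- exact: norm_tail.
- exact: gW.
by rewrite subnSK //; apply: IHj; apply: ltnW.
Qed.

Lemma ogood_tail d m y : y \in L :\: N ->
    (forall i, i < p -> ogood d m N 'C(W :^ (y ^+ i))%G) ->
  forall j, j <= p -> ogood (d ^ j)%N (m ^ j)%N N 'C(tail y (p - j))%G.
Proof.
move=> Ny gW; elim=> [_ M sMN|j IHj lt_jp].
  by rewrite subn0 /= (tail_end Ny) cent1T setIT !mul1n.
have lt_p : p - j.+1 < p by rewrite ltn_subrL (prime_gt0 pr).
rewrite !expnS; apply: (ogood_dprod (tail_dprod Ny lt_p)); first exact: gW.
by rewrite subnSK //; apply: IHj; apply: ltnW.
Qed.

End ImprimitiveCounting.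

(** * Bounds on the order and on the number of orbits *)

Lemma arith_semiregular w l f : 2 < w -> l < w -> f = l + w.-1 ->
  9 * f <= 4 * w ^ 2 /\ 9 * l <= 2 * w ^ 2.
Proof.
case: w => [|[|[|w]]] // _; rewrite ltnS => ll -> /=; rewrite !expnS expn0 muln1.
by split; nia.
Qed.

Lemma arith_index2 w a l f : 7 < a -> a < w -> l = a * 2 ->
    f <= l + 2 * w.-1 ->
  9 * f <= 4 * w ^ 2 /\ 9 * l <= 2 * w ^ 2.
Proof.
move=> lt7 ltw -> lef; have {}lef : f <= 4 * w.-1 by lia.
have lt9 : 8 < w by lia.
move: ltw lef lt9; case: w => // w /= ltw lef lt9; rewrite !expnS expn0 muln1.
by split; nia.
Qed.

Lemma arith_reducible u r f l : 2 * 2 * f <= u ^ 2 * r ^ 2 ->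
    4 * 4 * l <= u ^ 2 * r ^ 2 ->
  9 * f <= 4 * (u * r) ^ 2 /\ 9 * l <= 2 * (u * r) ^ 2.
Proof. by rewrite -expnMn; set z := _ ^ 2 => *; lia. Qed.

Lemma leq_exp_imprim p : 1 < p -> 8 * p <= 4 ^ p /\ 8 * p.-1 <= 2 * 4 ^ p.-1.
Proof.
have le4 : forall n, 8 * n.+2 <= 4 ^ n.+2.
  by elim=> // n IHn; rewrite expnS; lia.
case: p => [|[|[|p]]] // _; split=> /=; first exact: (le4 p.+1).
by have := le4 p; lia.
Qed.

(** Here w2 = w ^ 2 for the order w of a block, wp = w2 ^ p, f = fixsum V N,
    s = \sum_(y in L :\: N) #|'C_V[y]|, n = #|N|, k = #|'C_N(R)| and
    c = fixsum W 'C_N(R). Each of f and s accounts for a part of 4 / 9, namely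
    1 / 4 and 1 / 8. *)
Lemma arith_imprim p f n w2 wp wq k c s : 1 < p -> 4 <= 2 ^ p ->
    8 * p <= 4 ^ p -> 8 * p.-1 <= 2 * 4 ^ p.-1 ->
    2 ^ p * f <= wp -> 4 ^ p * n <= wp -> w2 * wq = wp ->
    4 ^ p.-1 * n <= wq * k -> 2 * c <= w2 -> s * k <= p.-1 * n * c -> 0 < k ->
  9 * (f + s) <= 4 * wp /\ 9 * (n * p) <= 2 * wp.
Proof.
move=> lt1p; set P := 2 ^ p; set Q := 4 ^ p; set Q1 := 4 ^ p.-1; set p1 := p.-1.
move=> le4 le8 le81 lef len ewp lek lec les k0.
have f4 : 4 * f <= wp by apply: leq_trans lef; rewrite leq_mul2r le4 orbT.
have n8 : 8 * p * n <= wp by apply: leq_trans len; rewrite leq_mul2r le8 orbT.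
have p10 : 0 < p1 by rewrite /p1; case: p lt1p {P Q Q1 p1 le4 le8 le81 lef len lek les n8} => [|[]].
have s8 : 8 * s <= wp.
  rewrite -(leq_pmul2r k0) -(leq_pmul2l p10) -ewp.
  apply: (@leq_trans (2 * Q1 * s * k)).
    by rewrite !mulnA leq_mul2r (mulnC p1) leq_mul2r le81 !orbT.
  apply: (@leq_trans (2 * Q1 * (p1 * n * c))); first by rewrite -[leqLHS]mulnA leq_mul2l les orbT.
  apply: (@leq_trans ((2 * c) * p1 * (Q1 * n))); first by apply/eq_leq; ring.
  apply: (@leq_trans (w2 * p1 * (wq * k))); last by apply/eq_leq; ring.
  by apply: leq_mul => //; rewrite leq_mul2r lec orbT.
by split; lia.
Qed.

Section Bounds.
Local Open Scope group_scope.

(** The only nontrivial element of V is fixed by L. *)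
Lemma faithful_card2 q (gT : finGroupType) (V L : {group gT}) :
  nilmod q V L -> 'C_L(V) = 1 -> #|V| = 2 -> L :=: 1.
Proof.
case/and4P=> _ _ nVL _ fV oV; rewrite -fV; apply/esym/setIidPl.
have : #|V :\ 1| == 1%N by have := cardsD1 1 V; rewrite oV group1 add1n => -[<-].
case/cards1P=> v eV; apply/subsetP=> x Lx; apply/centP=> u Vu.
have [-> | nu1] := eqVneq u 1; first exact: commute1.
have eu t : t \in V -> t != 1 -> t = v.
  by move=> Vt nt1; apply/set1P; rewrite -eV !inE nt1.
have eux : u ^ x = v.
  by apply: eu; rewrite ?memJ_norm ?(subsetP nVL) // conjg_eq1.
by apply/commute_sym/commgP/conjg_fixP; rewrite eux (eu u).
Qed.

(** For V of order 2 the stronger bounds fail and the weaker ones are attained. The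
    latter suffice for the factors of a direct product, where constants are
    multiplied: 1 / 2 ^ 2 <= 4 / 9 and 1 / 4 ^ 2 <= 2 / 9. *)
Lemma weak_bounds q (gT : finGroupType) (V L : {group gT}) :
    nilmod q V L -> 'C_L(V) = 1 -> 1 < #|V| ->
    (2 < #|V| -> (9 * fixsum V L <= 4 * #|V| ^ 2)%N /\ (9 * #|L| <= 2 * #|V| ^ 2)%N) ->
  (2 * fixsum V L <= #|V| ^ 2)%N /\ (4 * #|L| <= #|V| ^ 2)%N.
Proof.
move=> mVL fV lt1V; have [lt2V /(_ isT)[] | le2V _] := ltnP 2 #|V|; first by lia.
have oV : #|V| = 2 by apply/eqP; rewrite eqn_leq le2V.
have L1 := faithful_card2 mVL fV oV.
rewrite oV L1 cards1 fixsumC big_set1 cent11T setIT oV; split=> //.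
Qed.

Lemma block_bounds q (gT : finGroupType) (U L : {group gT}) :
    nilmod q U L -> 1 < #|U| ->
    (forall (rT : finGroupType) (V M : {group rT}), nilmod q V M -> 'C_M(V) = 1 ->
       #|V| = #|U| -> 2 < #|V| ->
       (9 * fixsum V M <= 4 * #|V| ^ 2)%N /\ (9 * #|M| <= 2 * #|V| ^ 2)%N) ->
  sgood 2 (#|U| ^ 2) L (stabs U) 'C(U)%G /\ ogood 4 (#|U| ^ 2) L 'C(U)%G.
Proof.
move=> mUL lt1U IH.
have bd (M : {group gT}) : M \subset L ->
    (2 * fixsum (U / 'C_M(U)) (M / 'C_M(U)) <= #|U| ^ 2)%N
    /\ (4 * #|M / 'C_M(U)| <= #|U| ^ 2)%N.
  move=> sML; have [_ _ nUL _] := and4P mUL.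
  have mUM : nilmod q U M := (nilmodS mUL (subxx U) sML (subset_trans sML nUL)).
  have [mq fq _ _] := nilmod_quotient mUM.
  have oq : #|U / 'C_M(U)| = #|U| := card_quotient_mod mUM.
  have := weak_bounds mq fq; have := IH _ _ _ mq fq oq; rewrite /= oq => IHq.
  by apply.
by split; [apply: (sgood_stabs mUL) | apply: (ogood_mod mUL)] => M /bd[].
Qed.

(** The constants are those needed for imprimitive groups of index 2, where the
    two bounds are added; for a group of order 2 acting on one of order 3 both
    are attained. *)
Theorem module_bounds q (gT : finGroupType) (V L : {group gT}) :
    nilmod q V L -> 'C_L(V) = 1 -> 2 < #|V| ->
  (9 * fixsum V L <= 4 * #|V| ^ 2)%N /\ (9 * #|L| <= 2 * #|V| ^ 2)%N.
Proof.
have [n] := ubnP #|V|; elim: n => // n IHn in gT V L * => ltVn mVL fV lt2V.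
have [abV q'L nVL nilL] := and4P mVL.
have ntV : V :!=: 1 by rewrite -cardG_gt1 ltnW.
have IH (U M : {group gT}) : U \proper V -> M \subset L -> M \subset 'N(U) ->
    U :!=: 1 -> sgood 2 (#|U| ^ 2) M (stabs U) 'C(U)%G /\ ogood 4 (#|U| ^ 2) M 'C(U)%G.
  move=> prU sML nUM ntU; apply: block_bounds (nilmodS mVL (proper_sub prU) sML nUM) _ _.
    by rewrite cardG_gt1.
  move=> rT V' M' mV' fV' oV'; apply: IHn => //; rewrite oV'.
  exact: leq_trans (proper_card prU) ltVn.
case: (nilmod_cases mVL fV ntV) => [[U [R [dV ntU ntR nUL nRL]]] | sreg | [A data] | [p [N [W [R data]]]]].
- have oV := dprod_card dV.
  have lt1 (X : {group gT}) : X :!=: 1 -> 1 < #|X| by rewrite cardG_gt1.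
  have [_ eV _ _] := dprodP dV.
  have pU : U \proper V.
    by rewrite properEcard -{1}eV mulG_subl -oV ltn_Pmulr ?lt1.
  have pR : R \proper V.
    by rewrite properEcard -{1}eV mulG_subr -oV ltn_Pmull ?lt1.
  have [sU oU] := IH U L pU (subxx L) nUL ntU; have [sR oR] := IH R L pR (subxx L) nRL ntR.
  have := sgood_dprod dV nUL nRL sU sR (subxx L).
  rewrite (sum_stabs V (fun X => #|L :&: X|)) fV cards1 muln1 => bf.
  have := ogood_dprod dV oU oR (subxx L); rewrite fV cards1 muln1 => bl.
  by rewrite -oV; apply: arith_reducible.
- apply: arith_semiregular lt2V _ (fixsum_semiregular sreg).
  exact: semiregular_card.
- case: data => nsA _ idx sreg [lt7 _]; have sAL := normal_sub nsA.
  have ltAV : #|A| < #|V| by apply: semiregular_card; rewrite ?(subset_trans sAL).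
  have cardL : (#|L| = #|A| * 2)%N by rewrite -(Lagrange sAL) idx.
  apply: (arith_index2 lt7 ltAV cardL).
  rewrite (fixsum_setD V sAL) (fixsum_semiregular sreg).
  have := sum_cent_index2 sAL idx sreg; rewrite cardL; set s := \sum_(y in _) _; lia.
have [[pr nsNL idxN] [ntW dV nWN nRN] _ _ [ltpW _]] := data.
have sNL := normal_sub nsNL; have lt1p := prime_gt1 pr; have p0 := prime_gt0 pr.
have oV : (#|V| = #|W| ^ p)%N := imprim_cardV mVL data.
have [y Ny] : exists y, y \in L :\: N.
  apply/set0Pn; rewrite setD_eq0; apply/negP=> sLN.
  by move: lt1p; rewrite -idxN; move: sLN; rewrite -indexg_eq1 => /eqP->.
have [Ly _] := setDP Ny.
have lt1W : 1 < #|W| by rewrite cardG_gt1.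
have block i : i < p -> sgood 2 (#|W| ^ 2) N (stabs (W :^ (y ^+ i))%G) 'C(W :^ (y ^+ i))%G
                     /\ ogood 4 (#|W| ^ 2) N 'C(W :^ (y ^+ i))%G.
  move=> lt_ip; rewrite -(cardJg W (y ^+ i)); apply: IH => //.
  - rewrite properEcard cardJg oV -{1}(normsP nVL _ (groupX i Ly)) conjSg.
    have [_ eV _ _] := dprodP dV; rewrite -{1}eV mulG_subl.
    by rewrite -{1}[#|W|]expn1 ltn_exp2l.
  - exact: (norm_block data).
  by rewrite -cardG_gt1 cardJg.
have sgT := sgood_tail mVL data Ny (fun i lt => proj1 (block i lt)).
have ogT := ogood_tail mVL data Ny (fun i lt => proj2 (block i lt)).
have e0 : tail V R y (p - p) :=: V by rewrite subnn (tail0 V R y).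
have e1 : tail V R y (p - p.-1) :=: R.
  by rewrite -{1}(prednK p0) subSnn (tail1 data).
have cN : 'C_N(V) = 1 by apply/trivgP; rewrite -fV setSI.
have fN : (2 ^ p * fixsum V N <= (#|W| ^ 2) ^ p)%N.
  have := sgT p (leqnn p) N (subxx N); rewrite e0.
  by rewrite (sum_stabs _ (fun X => #|N :&: X|)) e0 cN cards1 muln1.
have lN : (4 ^ p * #|N| <= (#|W| ^ 2) ^ p)%N.
  by have := ogT p (leqnn p) N (subxx N); rewrite /= e0 cN cards1 muln1.
have lK : (4 ^ p.-1 * #|N| <= (#|W| ^ 2) ^ p.-1 * #|'C_N(R)|)%N.
  by have := ogT p.-1 (leq_pred p) N (subxx N); rewrite /= e1.
pose K := 'C_N(R)%G; have sKN : K \subset N := subsetIl _ _.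
have fK : 'C_K(W) = 1.
  have [_ eV _ _] := dprodP dV.
  by apply/trivgP; rewrite -cN -eV centM setIA setIAC.
have fixK : (2 * fixsum W K <= #|W| ^ 2)%N.
  have [gW _] := block 0 p0; have := gW K sKN.
  rewrite (sum_stabs _ (fun X => #|K :&: X|)) /= conjsg1.
  by rewrite -[_ :&: 'C(W)]/('C_K(W)) fK cards1 muln1.
have sumK := sum_cent_imprim data; rewrite (imprim_card_out data) -/K in sumK.
have eW : ((#|W| ^ p) ^ 2 = (#|W| ^ 2) ^ p)%N by rewrite -!expnM mulnC.
rewrite (fixsum_setD V sNL) -(Lagrange sNL) idxN oV eW.
have [le8p le8p1] := leq_exp_imprim lt1p.
have le4 : 4 <= 2 ^ p by rewrite -[4]/(2 ^ 2)%N leq_exp2l.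
apply: (arith_imprim lt1p le4 le8p le8p1 fN lN _ lK fixK sumK).
  by rewrite -expnS prednK.
exact: cardG_gt0.
Qed.

End Bounds.

(** * The class number bound for modules *)

Section ClassBound.
Local Open Scope group_scope.
Variable gT : finGroupType.
Implicit Types V L N W R A X : {group gT}.

(** The number of pairs (v, x) with v in V and x in N such that x, v and y commute
    pairwise. *)
Definition outer_sum V N (y : gT) : nat :=
  \sum_(v in 'C_V[y]) #|'C_N[y] :&: 'C[v]|.

(** Add the bounds of ncomm_index in the stabilisers of the points of V. *)
Lemma fixcomm_index V L N : N \subset L ->
  (fixcomm V L <= fixcomm V N
     + #|L : N|.+1 * \sum_(y in L :\: N) outer_sum V N y)%N.
Proof.
move=> sNL.
apply: (@leq_trans (\sum_(v in V) (ncomm 'C_N[v]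
    + #|L : N|.+1 * \sum_(y in 'C_L[v] :\: N) #|'C_N[y] :&: 'C[v]|))).
  apply: leq_sum => v Vv; have := ncomm_index sNL (subsetIl L 'C[v]).
  rewrite setIAC (setIidPr sNL) => /leq_trans-> //; rewrite leq_add2l leq_mul2l.
  by apply/orP; right; apply: leq_sum => y _; rewrite setIAC.
rewrite big_split /= leq_add2l -big_distrr leq_mul2l; apply/orP; right => /=.
rewrite (exchange_big_dep (mem (L :\: N))) /=; last first.
  by move=> v y _; rewrite !in_setD in_setI => /and3P[-> ->].
apply: leq_sum => y Ny; rewrite /outer_sum [leqRHS]big_mkcond [leqLHS]big_mkcond /=.
apply: leq_sum => v _; rewrite !in_setD !in_setI; case: (v \in V) => //=.
have [Ly nNy] := setDP Ny; rewrite Ly nNy /= (cent1C v).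
by case: (y \in 'C[v]).
Qed.

Lemma fixcomm_semiregular V L : semiregular V L ->
  (fixcomm V L = ncomm L + #|V|.-1)%N.
Proof.
move=> sreg; rewrite /fixcomm (big_setD1 1) //= cent11T setIT; congr (_ + _)%N.
rewrite (eq_bigr (fun=> 1%N)) => [|v /setD1P[nv1 Vv]].
  by rewrite sum_nat_const muln1 (cardsD1 1 V) group1.
rewrite (semiregular_stab sreg) // (ncomm_abelian (abelian1 _)).
by rewrite cards1.
Qed.

Lemma class_bound_semiregular V L : semiregular V L -> L \subset 'N(V) ->
  V :!=: 1 -> (fixcomm V L <= #|L| * #|V|)%N.
Proof.
move=> sreg nVL ntV; have lt := semiregular_card sreg nVL ntV.
rewrite (fixcomm_semiregular sreg); have := ncomm_le L; rewrite expnS expn1.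
move: lt (cardG_gt0 L); case: #|V| => // w; rewrite ltnS /= => le_lw l0 le_n.
by rewrite mulnS; nia.
Qed.

(** The pairs inside A are covered by the semiregular bound. For y outside A only
    v = 1 is fixed by more than one element of 'C_A[y], and this centraliser has at
    most a quarter of the order of A, which pays for the factor 3 = #|L : A| + 1. *)
Lemma class_bound_index2 V L A : index2_data V L A -> L \subset 'N(V) ->
  V :!=: 1 -> (fixcomm V L <= #|L| * #|V|)%N.
Proof.
case=> nsA cAA idx sreg [lt7 le4] nVL ntV; have sAL := normal_sub nsA.
have nVA := subset_trans sAL nVL; have ltV := semiregular_card sreg nVA ntV.
have := class_bound_semiregular sreg nVA ntV.
have := fixcomm_index V sAL; rewrite idx.
have leS y : y \in L :\: A -> (4 * outer_sum V A y <= #|A| + 4 * #|'C_V[y]|.-1)%N.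
  move=> Ay; rewrite /outer_sum (big_setD1 1) ?group1 //= cent11T setIT.
  rewrite mulnDr leq_add ?le4 // leq_mul2l /=.
  rewrite (eq_bigr (fun=> 1%N)) => [|v /setD1P[nv1 /setIP[Vv _]]].
    by rewrite sum_nat_const muln1 (cardsD1 1 'C_V[y]) group1.
  by rewrite setIAC (semiregular_stab sreg) // setI1g cards1.
have leT : (4 * \sum_(y in L :\: A) outer_sum V A y
    <= #|A| * #|A| + 4 * #|V|.-1)%N.
  have cardLA : #|L :\: A| = #|A|.
    by rewrite cardsD (setIidPr sAL) -(Lagrange sAL) idx muln2 -addnn addnK.
  have : (4 * \sum_(y in L :\: A) outer_sum V A y + 4 * \sum_(y in L :\: A) 1
     <= \sum_(y in L :\: A) #|A| + 4 * \sum_(y in L :\: A) #|'C_V[y]|)%N.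
    rewrite !big_distrr /= -!big_split /=; apply: leq_sum => y /leS.
    by have := cardG_gt0 'C_V[y]; case: #|_| => // c _ /=; lia.
  rewrite !sum_nat_const muln1 cardLA => h1.
  have := sum_cent_index2 sAL idx sreg.
  by move: h1; set s := \sum_(y in _) _; set t := \sum_(y in _) _; lia.
rewrite -(Lagrange sAL) idx; move: leT lt7 ltV.
set s := \sum_(y in _) _; case: #|V| => // w /=; set a := #|A|.
set f := fixcomm _ _; set g := fixcomm _ _; clearbody s a f g.
move=> leT lt7 ltV le1 le2; apply: leq_trans le1 _.
have key : 3 * (a * a + 4 * w) <= 4 * (a * w.+1) by nia.
by nia.
Qed.

Lemma leq_sum_sub (T : finType) (A B : {set T}) (F : T -> nat) :
  A \subset B -> \sum_(x in A) F x <= \sum_(x in B) F x.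
Proof. by move=> sAB; rewrite [leqRHS](big_setID A) /= (setIidPr sAB) leq_addr. Qed.

End ClassBound.

Lemma arith_pair s t c x w : s + t <= c + x -> 9 * c <= 4 * w -> 9 * x <= 2 * w ->
  9 * (s + t) <= 6 * w.
Proof. lia. Qed.

Lemma arith_sum_pair s n w : 9 * (s + s) <= n * (6 * w) -> 3 * s <= n * w.
Proof. by rewrite mulnCA; lia. Qed.

Lemma leq_add_mulS a b : 0 < a -> 0 < b -> a + b <= a * b + 1.
Proof. by move=> a0 b0; nia. Qed.

Section ImprimitiveClassBound.
Local Open Scope group_scope.
Variables (gT : finGroupType) (q : nat) (V L : {group gT}) (p : nat).
Variables (N W R : {group gT}).
Hypotheses (mVL : nilmod q V L) (fV : 'C_L(V) = 1).
Hypothesis data : imprimitive_data V L p N W R.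

(** If x centralises W and y then [~: V, <[x]>] lies in R and is invariant under y. *)
Lemma imprim_faithful y : y \in L :\: N -> 'C_('C_N[y])(W) = 1.
Proof.
move=> Ny; have [[pr nsNL idxN] [ntW dV nWN nRN] _ core _] := data.
have [Ly _] := setDP Ny; have [_ eV cWR tiWR] := dprodP dV.
have [_ _ nVL _] := and4P mVL.
apply/trivgP/subsetP=> x /setIP[/setIP[Nx cyx] cWx].
pose U := [~: V, <[x]>]%G.
have sxN : <[x]> \subset N by rewrite cycle_subG.
have sxC : <[x]> \subset 'C(W) by rewrite cycle_subG.
have sUR : U \subset R.
  rewrite gen_subG; apply/subsetP=> _ /imset2P[v z Vv xz ->].
  move: Vv; rewrite -eV => /mulsgP[w r Ww Rr ->].
  rewrite commgEl conjMg.
  have -> : w ^ z = w.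
    by apply/conjg_fixP/commgP/commute_sym; apply: (centP (subsetP sxC z xz)).
  rewrite invMg -mulgA mulKg groupM ?groupV // memJ_norm //.
  exact: subsetP (subset_trans sxN nRN) z xz.
have nUy : y \in 'N(U).
  rewrite -cycle_subG normsR //; first by rewrite cycle_subG (subsetP nVL).
  by rewrite cents_norm // cent_cycle cycle_subG cent1C.
have U1 := core U sUR y Ny nUy.
have cVx : x \in 'C(V).
  have : V \subset 'C(<[x]>) by apply/commG1P.
  by rewrite centsC cycle_subG.
by rewrite -fV inE cVx andbT (subsetP (normal_sub nsNL)).
Qed.

Lemma imprim_nilmod y : nilmod q W 'C_N[y]%G.
Proof.
have [[_ nsNL _] [_ dV nWN _] _ _ _] := data.
have [_ eV _ _] := dprodP dV.
apply: nilmodS mVL _ _ _; first by rewrite -eV mulG_subl.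
  by rewrite subIset // (normal_sub nsNL).
by rewrite subIset ?nWN.
Qed.

(** The projection onto W is injective on the fixed points of y and maps them to
    fixed points of y ^+ p. *)
Lemma outer_sum_block y : y \in L :\: N ->
  (outer_sum V N y <= \sum_(u in 'C_W[y ^+ p]) #|'C_N[y] :&: 'C[u]|)%N.
Proof.
move=> Ny; have [f [fW finj ffix fcen]] := imprim_component data.
rewrite /outer_sum.
apply: (@leq_trans (\sum_(v in 'C_V[y]) #|'C_N[y] :&: 'C[f v]|)).
  apply: leq_sum => v /setIP[Vv _]; apply/subset_leq_card/subsetP=> x.
  by rewrite !in_setI -!andbA => /and3P[Nx -> cvx]; rewrite Nx (fcen x v).
rewrite -(big_imset (fun u => #|'C_N[y] :&: 'C[u]|) (finj y Ny)) /=.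
apply: leq_sum_sub; apply/subsetP=> _ /imsetP[v Cv ->].
by rewrite inE ffix // andbT fW //; case/setIP: Cv.
Qed.

Lemma imprim_bounds y : y \in L :\: N ->
  (9 * fixsum W 'C_N[y] <= 4 * #|W| ^ 2)%N /\ (9 * #|'C_N[y]| <= 2 * #|W| ^ 2)%N.
Proof.
move=> Ny; have [[pr _ _] _ _ _ [ltpW _]] := data.
apply: (module_bounds (imprim_nilmod y) (imprim_faithful Ny)).
exact: leq_ltn_trans (prime_gt1 pr) ltpW.
Qed.

(** The factor e acts without fixed points on W, so y ^+ 2 and (e * y) ^+ 2 have
    no common fixed point there. For x commuting with y, their groups of fixed
    points in 'C_W[x] thus have orders a and b with a * b <= #|'C_W[x]|, and
    a + b <= a * b + 1. *)
Lemma outer_sum_pair y e : p = 2 -> e \in 'Z(N) -> 'C_W[e] = 1 ->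
    e ^ y^-1 \in 'C(W) -> y \in L :\: N ->
  (outer_sum V N y + outer_sum V N (e * y) <= fixsum W 'C_N[y] + #|'C_N[y]|)%N.
Proof.
move=> p2 /setIP[Ne cNe] tiWe ceW Ny; have [Ly nNy] := setDP Ny.
have [[_ nsNL _] [_ dV nWN _] _ _ _] := data.
have sNL := normal_sub nsNL; have Le := subsetP sNL e Ne.
have Ney : e * y \in L :\: N by apply/setDP; rewrite !groupMl.
have eX : 'C_N[e * y] = 'C_N[y].
  apply/setP=> x; rewrite !in_setI; case Nx: (x \in N) => //=.
  have cex : e \in 'C[x] by apply: (subsetP _ e cNe); rewrite -cent_set1 centS ?sub1set.
  by rewrite !(cent1C x) groupMl.
apply: leq_trans (leq_add (outer_sum_block Ny) (outer_sum_block Ney)) _.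
rewrite eX p2 (exchange_cent 'C_W[y ^+ 2]) (exchange_cent 'C_W[(e * y) ^+ 2]).
rewrite -big_split /= fixsumC -[X in (_ <= _ + X)%N]sum1_card -big_split /=.
apply: leq_sum => x _.
have ti : 'C_('C_W[y ^+ 2])[x] :&: 'C_('C_W[(e * y) ^+ 2])[x] = 1.
  apply/trivgP/subsetP=> u /setIP[/setIP[/setIP[Wu cy] _] /setIP[/setIP[_ cey] _]].
  rewrite -tiWe inE Wu /=; rewrite !(cent1C u) in cy cey *.
  apply/cent1P/commute_sym/commgP/conjg_fixP; apply: (conjg_inj (y ^+ 2)).
  have fy : u ^ (y ^+ 2) = u by apply/conjg_fixP/commgP/commute_sym/cent1P.
  have : u ^ ((e * y) ^+ 2) = u by apply/conjg_fixP/commgP/commute_sym/cent1P.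
  have -> : (e * y) ^+ 2 = e * (e ^ y^-1) * y ^+ 2.
    by rewrite /conjg invgK !(expgS _ 1) !expg1 !mulgA mulgKV.
  rewrite conjgM (conjgM u e); have -> : (u ^ e) ^ (e ^ y^-1) = u ^ e.
    apply/conjg_fixP/commgP/commute_sym; apply: (centP ceW).
    by rewrite memJ_norm // (subsetP nWN).
  by rewrite fy.
have : (#|'C_('C_W[y ^+ 2])[x]| * #|'C_('C_W[(e * y) ^+ 2])[x]| <= #|'C_W[x]|)%N.
  rewrite -TI_cardMg //; apply: subset_leq_card.
  by rewrite mul_subG ?setSI ?subsetIl.
by rewrite -(leq_add2r 1); apply: leq_trans; apply: leq_add_mulS; apply: cardG_gt0.
Qed.

(** For p odd each outer sum is at most fixsum W 'C_N[y] <= #|W| ^ 2, and the factor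
    p + 1 is at most #|W|, while V has order #|W| ^ p with p >= 3. For p = 2 the
    outer sums must have mean at most #|W| ^ 2 / 3; here y is paired with e * y, and
    the constants of module_bounds give 4 / 9 + 2 / 9 = 2 / 3 for two summands. *)
Lemma sum_outer_imprim :
  (p.+1 * \sum_(y in L :\: N) outer_sum V N y <= #|L :\: N| * #|V|)%N.
Proof.
have [[pr nsNL idxN] [ntW dV nWN nRN] _ _ [ltpW flip]] := data.
have oV := imprim_cardV mVL data; have sNL := normal_sub nsNL.
have [p2 | np2] := eqVneq p 2; last first.
  rewrite big_distrr -sum_nat_const; apply: leq_sum => y Ny /=.
  have [bd _] := imprim_bounds Ny.
  have : (outer_sum V N y <= #|W| ^ 2)%N.
    apply: (@leq_trans (fixsum W 'C_N[y])); last by lia.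
    by apply: leq_trans (outer_sum_block Ny) _; apply: leq_sum_sub; apply: subsetIl.
  move=> leS; apply: leq_trans (leq_mul ltpW leS) _; rewrite -expnS oV.
  have lt1p := prime_gt1 pr.
  have lt2p : 2 < p by rewrite ltn_neqAle eq_sym np2.
  by rewrite leq_exp2l // (ltn_trans lt1p ltpW).
have [e Ze [tiWe ceW]] := flip p2; have [Ne _] := setIP Ze.
have Le := subsetP sNL e Ne.
have pair : (\sum_(y in L :\: N) outer_sum V N y
     = \sum_(y in L :\: N) outer_sum V N (e * y))%N.
  rewrite (reindex_inj (mulgI e)) /=; apply: eq_bigl => y.
  by rewrite !in_setD !groupMl.
have : (9 * (\sum_(y in L :\: N) outer_sum V N y
           + \sum_(y in L :\: N) outer_sum V N (e * y))
    <= #|L :\: N| * (6 * #|W| ^ 2))%N.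
  rewrite -big_split big_distrr -sum_nat_const; apply: leq_sum => y Ny /=.
  have [bc bx] := imprim_bounds Ny.
  exact: arith_pair (outer_sum_pair p2 Ze tiWe (ceW y Ny) Ny) bc bx.
by rewrite -pair oV p2; apply: arith_sum_pair.
Qed.

End ImprimitiveClassBound.

Section ClassTheorem.
Local Open Scope group_scope.

(** For reducible V the families of stabilisers of two invariant factors are
    combined by kgood_meets; the induction hypothesis applies to both. For
    imprimitive V the pairs inside N are bounded by induction and the others by
    sum_outer_imprim. *)
Theorem module_class_bound q (gT : finGroupType) (V L : {group gT}) :
  nilmod q V L -> 'C_L(V) = 1 -> (fixcomm V L <= #|L| * #|V|)%N.
Proof.
have [n] := ubnP (#|V| + #|L|)%N; elim: n => // n IHn in gT V L *.
rewrite ltnS => le_n mVL fV; have [abV q'L nVL nilL] := and4P mVL.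
have [V1 | ntV] := eqVneq (V : {set gT}) 1.
  rewrite V1 /fixcomm big_set1 cent11T setIT cards1 muln1.
  suff -> : L :=: 1 by rewrite cards1 (ncomm_abelian (abelian1 _)) cards1.
  by rewrite -fV V1 cent1T setIT.
case: (nilmod_cases mVL fV ntV) => [[U [R [dV ntU ntR nUL nRL]]] | sreg | [A data] | [p [N [W [R data]]]]].
- have oV := dprod_card dV; have [_ eV _ _] := dprodP dV.
  have lt1 (X : {group gT}) : X :!=: 1 -> 1 < #|X| by rewrite cardG_gt1.
  have good (X : {group gT}) : X \subset V -> #|X| < #|V| -> L \subset 'N(X) ->
      kgood L (stabs X) 'C(X)%G.
    move=> sXV ltX nXL; have mX := nilmodS mVL sXV (subxx L) nXL.
    apply: (kgood_stabs mX) => M sML.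
    have mXM := nilmodS mVL sXV sML (subset_trans sML nXL).
    have [mq fq _ _] := nilmod_quotient mXM.
    have oq : #|X / 'C_M(X)| = #|X| := card_quotient_mod mXM.
    have := IHn _ _ _ _ mq fq; rewrite /= oq; apply.
    apply: leq_trans le_n; rewrite -addSn leq_add //.
    by rewrite (leq_trans (leq_quotient _ _)) ?subset_leq_card.
  have gU : kgood L (stabs U) 'C(U)%G.
    by apply: good; rewrite // -?eV ?mulG_subl // eV -oV ltn_Pmulr ?lt1.
  have gR : kgood L (stabs R) 'C(R)%G.
    by apply: good; rewrite // -?eV ?mulG_subr // eV -oV ltn_Pmull ?lt1.
  have := kgood_dprod dV nUL nRL gU gR (subxx L).
  rewrite (sum_stabs V (fun X => ncomm (L :&: X))) size_stabs /= fV cards1 muln1.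
  by rewrite (ncomm_abelian (abelian1 _)) cards1 muln1.
- exact: class_bound_semiregular.
- exact: class_bound_index2 data nVL ntV.
have [[pr nsNL idxN] _ _ _ _] := data; have sNL := normal_sub nsNL.
have ltNL : #|N| < #|L| by rewrite -(Lagrange sNL) idxN ltn_Pmulr ?prime_gt1.
have leN : (fixcomm V N <= #|N| * #|V|)%N.
  apply: IHn; last by apply/trivgP; rewrite -fV setSI.
    by apply: leq_trans le_n; rewrite -addnS leq_add2l.
  exact: (nilmodS mVL (subxx V) sNL (subset_trans sNL nVL)).
apply: leq_trans (fixcomm_index V sNL) _; rewrite idxN.
apply: leq_trans (leq_add leN (sum_outer_imprim mVL fV data)) _.
rewrite -mulnDl leq_mul2r -{1}(setIidPr sNL) cardsID leqnn orbT //.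
Qed.

End ClassTheorem.

(** * Irreducible actions by automorphisms *)

Section Transfer.
Local Open Scope group_scope.

Lemma ncommS (gT : finGroupType) (A B : {set gT}) : A \subset B -> (ncomm A <= ncomm B)%N.
Proof.
move=> sAB; rewrite /ncomm; apply: leq_trans (leq_sum_sub _ sAB).
by apply: leq_sum => x _; apply/subset_leq_card/setSI.
Qed.

Lemma ncomm1 (gT : finGroupType) : ncomm (1 : {set gT}) = 1%N.
Proof. by rewrite (ncomm_abelian (abelian1 gT)) cards1. Qed.

(** By ncomm_morphim, L :&: f @*^-1 X has at most as many commuting pairs as its
    image, times those of the kernel of f on L. *)
Lemma kgood_morphpre (gT rT : finGroupType) (H : {group gT})
    (f : {morphism H >-> rT}) (Ss : seq {group rT}) (K : {group rT}) :
  f @* H :&: K = 1 -> kgood (f @* H)%G Ss K ->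
  kgood H [seq (f @*^-1 X)%G | X <- Ss] ('ker f)%G.
Proof.
move=> tiK gSs L sLH; rewrite size_map big_map /=.
have := gSs (f @* L)%G (morphimS f sLH).
have -> : f @* L :&: K = 1 by apply/trivgP; rewrite -tiK setSI ?morphimS.
rewrite ncomm1 cards1 !muln1 => le_f.
have le_sum : (\sum_(X <- Ss) ncomm (L :&: f @*^-1 X)
    <= (\sum_(X <- Ss) ncomm (f @* L :&: X)) * ncomm ('ker_L f))%N.
  rewrite big_distrl; apply: leq_sum => X _ /=.
  apply: leq_trans (ncomm_morphim f _) _ => /=; first by rewrite subIset ?sLH.
  have sLX : L :&: f @*^-1 X \subset H by rewrite subIset ?sLH.
  rewrite leq_mul //; apply: ncommS; last by rewrite setSI ?subsetIl.
  rewrite subsetI; apply/andP; split; first exact/morphimS/subsetIl.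
  by rewrite sub_morphim_pre // subsetIr.
have cardL : (#|f @* L| * #|'ker_L f| = #|L|)%N.
  by rewrite card_morphim (setIidPr sLH) -indexgI mulnC Lagrange ?subsetIl.
rewrite -cardL.
apply: leq_trans (leq_mul le_sum (leqnn _)) _.
apply: (@leq_trans ((#|f @* L| * size Ss) * ncomm ('ker_L f) * #|'ker_L f|)%N).
  by rewrite !leq_mul2r le_f !orbT.
by apply/eq_leq; ring.
Qed.

(** A normal q-subgroup has nontrivial fixed points on a q-group, so an
    irreducible faithful action in characteristic q has none. *)
Lemma minnormal_nil_pgroup q (gT : finGroupType) (V L : {group gT}) :
    q.-abelem V -> minnormal V L -> nilpotent L -> 'C_L(V) = 1 ->
  q^'.-group L.
Proof.
move=> abV minV nilL fV; have [/andP[ntV nVL] minVL] := mingroupP minV.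
have qV := abelem_pgroup abV; pose Q := 'O_q(L)%G.
have sQL : Q \subset L := pcore_sub q L.
have nVQ : Q \subset 'N(V) := subset_trans sQL nVL.
pose P := (V <*> Q)%G.
have qP : q.-group P by rewrite /= norm_joinEr // pgroupM qV pcore_pgroup.
have nsVP : V <| P by rewrite /normal joing_subl join_subG normG.
have ntC : 'C_V(Q) != 1.
  have := meet_center_nil (pgroup_nil qP) nsVP ntV; apply: contraNneq => C1.
  rewrite -subG1 -C1 setIS // subIset //; apply/orP; right.
  by rewrite centS ?joing_subr.
have nC : L \subset 'N('C_V(Q)) by rewrite normsI ?norms_cent ?gFnorm.
have eC : 'C_V(Q) = V.
  by apply: (minVL 'C_V(Q)%G); rewrite ?subsetIl //= ntC.
have Q1 : Q :=: 1.
  apply/trivgP; rewrite -fV subsetI sQL centsC.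
  by apply/setIidPl.
by have [_ <- _ _] := dprodP (nilpotent_pcoreC q nilL); rewrite [ 'O_q(L)]Q1 mul1g pcore_pgroup.
Qed.

(** The class number bound for a group H acting through rho, brought back to a
    family of subgroups of H itself: in the semidirect product of V by its
    automorphism group, the image of H is a faithful irreducible nilpotent group,
    of order prime to q by minnormal_nil_pgroup. The last clause says that the
    members of the family contain the stabilisers of the points of V, in the only
    form needed, for sums of a monotone function. *)
Lemma aut_family q (hT vT : finGroupType) (H : {group hT}) (V : {group vT})
    (rho : {morphism H >-> {perm vT}}) :
    rho @* H \subset Aut V -> q.-abelem V -> V :!=: 1 -> nilpotent H ->
    (forall U : {group vT}, U \subset V ->
      {in H & U, forall h u, rho h u \in U} -> U :=: 1 \/ U :=: V) ->
  exists Ss : seq {group hT},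
  [/\ size Ss = #|V|, kgood H Ss ('ker rho)%G, q^'.-group (rho @* H)
    & forall F : {set hT} -> nat, (forall A B : {group hT}, A \subset B -> F A <= F B) ->
      forall D : vT -> {group hT},
      {in V, forall v, D v \subset H /\ {in D v, forall h, rho h v = v}} ->
      \sum_(v in V) F (D v) <= \sum_(X <- Ss) F X].
Proof.
move=> sAut abV ntV nilH irr.
pose to := [Aut V]%gact.
pose s1 := sdpair1 to; pose s2 := sdpair2 to.
have rA h : h \in H -> rho h \in Aut V.
  by move=> Hh; apply: (subsetP sAut); apply: mem_morphim.
have fM : {in H &, {morph (fun h => s2 (rho h)) : x y / x * y}}.
  by move=> x y Hx Hy /=; rewrite morphM //; apply: sdpair2_morphM; apply: rA.
pose f : {morphism H >-> _} := Morphism fM.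
have fE h : f h = s2 (rho h) by [].
have fact v h : v \in V -> h \in H -> s1 (rho h v) = s1 v ^ f h.
  by move=> Vv Hh; rewrite fE -(sdpair_act to Vv (rA h Hh)).
have rhoV h v : h \in H -> v \in V -> rho h v \in V.
  by move=> Hh Vv; rewrite Aut_closed ?rA.
pose W := (s1 @* V)%G; pose B := (f @* H)%G.
have nWB : B \subset 'N(W).
  apply: subset_trans (im_sdpair_norm to); apply/subsetP=> _ /morphimP[h _ Hh ->].
  by rewrite /= mem_morphim ?rA.
have inj1 : {in V &, injective s1} by apply/injmP/injm_sdpair1.
have inj2 : {in Aut V &, injective s2} by apply/injmP/injm_sdpair2.
have s21 : s2 1 = 1 := morph1 (sdpair2_morphism to).
have kerf h : h \in H -> f h = 1 -> rho h = 1.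
  by move=> Hh fh1; apply: inj2; rewrite ?rA ?group1 // s21.
have fB : 'C_B(W) = 1.
  apply/trivgP/subsetP=> _ /setIP[/morphimP[h _ Hh ->] cWh].
  suff -> : f h = 1 by apply: set11.
  rewrite fE; suff -> : rho h = 1 by rewrite s21.
  apply: (@eq_Aut _ V); rewrite ?rA ?group1 // => v Vv; rewrite perm1.
  apply: inj1; rewrite ?rhoV // fact //.
  apply/conjg_fixP/commgP/commute_sym; apply: (centP cWh).
  exact: mem_morphim.
have abW : q.-abelem W by rewrite /= morphim_abelem.
have nilB : nilpotent B by rewrite /= morphim_nil.
have cardW : #|W| = #|V| by rewrite card_injm ?injm_sdpair1.
have minW : minnormal W B.
  apply/mingroupP; split; first by rewrite nWB andbT -cardG_gt1 cardW cardG_gt1.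
  move=> U /andP[ntU nUB] sUW; pose U0 := (s1 @*^-1 U)%G.
  have eU : s1 @* U0 = U by rewrite morphpreK.
  have sU0 : U0 \subset V by apply: subsetIl.
  case: (irr U0 sU0) => [h u Hh /morphpreP[Vu Uu]| U1 | UV].
  - apply/morphpreP; split; first exact: rhoV.
    suff : s1 (rho h u) \in U by [].
    by rewrite fact // memJ_norm // (subsetP nUB) // mem_morphim.
  - by case/eqP: ntU; rewrite -eU U1 morphim1.
  by rewrite -[U : {set _}]eU UV.
have mW : nilmod q W B.
  by apply/and4P; split=> //; apply: minnormal_nil_pgroup abW minW nilB fB.
have gW : kgood B (stabs W) 'C(W)%G.
  apply: (kgood_stabs mW) => M sMB.
  have mWM := nilmodS mW (subxx W) sMB (subset_trans sMB nWB).
  have [mq fq _ _] := nilmod_quotient mWM.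
  have oq : #|W / 'C_M(W)| = #|W| := card_quotient_mod mWM.
  by have := module_class_bound mq fq; rewrite /= oq.
have gH := kgood_morphpre fB gW.
have eK : ('ker f)%G = ('ker rho)%G.
  apply/val_inj/setP=> h /=; apply/idP/idP=> kh; have Hh := dom_ker kh.
    by apply/kerP => //; apply: kerf => //; apply: mker.
  by apply/kerP => //; rewrite fE mker // s21.
exists [seq (f @*^-1 X)%G | X <- stabs W]; split.
- by rewrite size_map size_stabs.
- by rewrite -eK.
- have [_ q'B _ _] := and4P mW.
  by move: q'B; rewrite /pgroup !card_morphim !setIid -[ 'ker rho]/(gval ('ker rho)%G) -eK.
move=> F monF D DP; rewrite big_map (sum_stabs W (fun X => F (f @*^-1 X))).
have -> : W = s1 @: V :> {set _} by rewrite /= morphimEdom.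
rewrite big_imset //=.
apply: leq_sum => v Vv; have [sDH fixD] := DP v Vv.
apply: (monF (D v) (f @*^-1 'C[s1 v])%G); apply/subsetP=> h Dh.
have Hh := subsetP sDH h Dh; apply/morphpreP; split=> //.
apply/cent1P/commute_sym/commgP/conjg_fixP; rewrite -fact //.
by rewrite fixD.
Qed.

End Transfer.

(** * Counting commuting pairs over a chief factor *)

Section Lift.
Local Open Scope group_scope.
Variables (gT : finGroupType) (L V : {group gT}).
Hypotheses (nsVL : V <| L) (cVV : abelian V).

Lemma comm_morphM x : x \in L -> {in V &, {morph (fun v => [~ v, x]) : u v / u * v}}.
Proof.
move=> Lx u v Vu Vv; rewrite commMgJ; congr (_ * _).
apply/conjg_fixP/commgP/(centsP cVV) => //.
by rewrite commgEl groupM ?groupV // memJ_norm // (subsetP (normal_norm nsVL)).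
Qed.

(** Two commuting cosets x V and y V with x and y commuting contain exactly as
    many commuting pairs as there are solutions of [u, y] = [v, x] in V; the
    splitting of V into [V, x] and the centraliser of x counts them. *)
Lemma leq_fiber_pairs x y : x \in L -> y \in L -> y \in 'C[x] ->
    {in V, forall v, [~ v, x] \in 'C[x] -> [~ v, x] = 1} ->
  (fiber_pairs (coset V) L (coset V x) (coset V y)
     <= #|V| * #|V :&: 'C[x] :&: 'C[y]|)%N.
Proof.
move=> Lx Ly cxy fpf; have nVL := normal_norm nsVL.
have nVx := subsetP nVL x Lx; have nVy := subsetP nVL y Ly.
pose f : {morphism V >-> gT} := Morphism (comm_morphM Lx).
have fE v : f v = [~ v, x] by [].
have Vcomm v z : v \in V -> z \in L -> [~ v, z] \in V.
  by move=> Vv Lz; rewrite commgEl groupM ?groupV // memJ_norm // (subsetP nVL).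
have kerf : 'ker f = 'C_V[x].
  apply/setP=> v; apply/idP/setIP=> [kv | [Vv cvx]].
    have Vv := dom_ker kv; split=> //; apply/cent1P/commgP.
    by rewrite -fE (mker kv).
  by apply/kerP => //; rewrite fE; apply/eqP/commgP/cent1P.
have sVxV : f @* V \subset V.
  by apply/subsetP=> _ /morphimP[v _ Vv ->]; rewrite fE Vcomm.
have cardV : (#|f @* V| * #|'C_V[x]| = #|V|)%N.
  rewrite card_morphim setIid kerf mulnC Lagrange ?subsetIl //.
have ti : f @* V :&: 'C_V[x] = 1.
  apply/trivgP/subsetP=> _ /setIP[/morphimP[v _ Vv ->] /setIP[_ cw]].
  by rewrite fE fpf ?set11.
have eV : f @* V * 'C_V[x] = V.
  by apply/eqP; rewrite eqEcard mul_subG ?subsetIl //= TI_cardMg // cardV.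
have cV v w : v \in V -> w \in V -> w \in 'C[v].
  move=> Vv Vw; have : V \subset 'C[v] by rewrite sub_cent1 (subsetP cVV).
  by move/subsetP; apply.
have eqV z t : z \in L -> t \in L -> coset V z = coset V t -> z^-1 * t \in V.
  move=> Lz Lt ezt; have nz := subsetP nVL z Lz; have nt := subsetP nVL t Lt.
  by apply: coset_idr; rewrite ?groupM ?groupV // morphM ?morphV ?groupV //= ezt mulVg.
pose C := (V :&: 'C[x] :&: 'C[y])%G.
pose E := [set z in L | (coset V z == coset V x) &&
   [exists t, [&& t \in L, coset V t == coset V y & t \in 'C[z]]]].
have leE : (fiber_pairs (coset V) L (coset V x) (coset V y) <= \sum_(z in E) #|'C_V[x]|)%N.
  rewrite /fiber_pairs big_mkcond [leqRHS]big_mkcond; apply: leq_sum => z _.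
  rewrite in_set; case Lz: (z \in L) => //=; case: eqP => //= eq_zx.
  case: existsP => [_ | nex].
    have := leq_cent_coset (coset_morphism V) z (coset V y) nVL.
    rewrite ker_coset (setIidPr (normal_sub nsVL)) => /leq_trans-> //.
    apply/subset_leq_card/subsetP=> v /setIP[Vv]; rewrite in_setI Vv !(cent1C v) /=.
    by move=> cvz; rewrite -(mulKVg z x) groupM // cV // eqV.
  rewrite leqn0 cards_eq0; apply/eqP/setP=> t; rewrite in_set in_set0.
  by apply/negbTE/negP=> Et; case: nex; exists t.
apply: leq_trans leE _; rewrite sum_nat_const.
have sE : E \subset x *: (f @* V * C).
  apply/subsetP=> z; rewrite in_set.
  case/and3P=> Lz /eqP ezx /existsP[t /and3P[Lt /eqP ety ctz]].
  have Vu : x^-1 * z \in V by apply: eqV.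
  have Vv : y^-1 * t \in V by apply: eqV.
  rewrite mem_lcoset; set u := x^-1 * z in Vu *; set v := y^-1 * t in Vv.
  have ez : z = x * u by rewrite mulKVg.
  have et : t = y * v by rewrite mulKVg.
  have cxy' : x * y = y * x by apply/esym/(cent1P cxy).
  have czt : z * t = t * z by apply/esym/(cent1P ctz).
  have eq_uv : u ^ y * v = v ^ x * u.
    apply: (mulgI (x * y)); rewrite {2}cxy' /conjg !mulgA !mulgK.
    by rewrite !mulgV !mul1g.
  have Vux : v ^ x \in V by rewrite memJ_norm // (subsetP nVL).
  have euv : [~ u, y] = [~ v, x].
    rewrite !commgEl (canRL (mulgK v) eq_uv).
    have cuv : v ^ x * u = u * v ^ x by apply: (cent1P (cV _ _ Vu Vux)).
    have cvv : v ^ x * v^-1 = v^-1 * v ^ x.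
      by apply: (cent1P (cV _ _ _ Vux)); rewrite groupV.
    by rewrite cuv -mulgA mulKg cvv.
  have /mulsgP[u1 u2 fu1 Cu2 eu] : u \in f @* V * 'C_V[x] by rewrite eV.
  have [Vu2 cxu2] := setIP Cu2; have Vu1 := subsetP sVxV u1 fu1.
  rewrite eu mem_mulg // !in_setI Vu2 cxu2 /=.
  have fu1y : u1 ^ y \in f @* V.
    case/morphimP: fu1 => v1 _ Vv1 ->; rewrite fE conjRg.
    have -> : x ^ y = x by apply/conjg_fixP/commgP.
    by rewrite -fE mem_morphim // memJ_norm // (subsetP nVL).
  have eqc : [~ u, y] = [~ u1, y] * [~ u2, y] by rewrite eu (comm_morphM Ly).
  have fu2 : [~ u2, y] \in f @* V.
    rewrite -(mulKg [~ u1, y] [~ u2, y]) -eqc euv groupM ?groupV //.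
      by rewrite commgEl groupM ?groupV.
    by rewrite -fE mem_morphim.
  have cu2 : [~ u2, y] \in 'C_V[x].
    have exy : x ^ y = x by apply/conjg_fixP/commgP.
    have c2 : u2 ^ y \in 'C[x] by rewrite -[X in 'C[X]]exy cent1J memJ_conjg.
    by rewrite in_setI Vcomm // commgEl groupM ?groupV.
  rewrite cent1C; apply/cent1P/commute_sym/commgP; rewrite -in_set1 -[[set 1]]ti.
  by rewrite in_setI fu2.
apply: leq_trans (leq_mul (subset_leq_card sE) (leqnn _)) _.
have tiC : f @* V :&: C = 1 by apply/trivgP; rewrite -ti setIS ?subsetIl.
by rewrite card_lcoset TI_cardMg // -cardV mulnAC.
Qed.

(** For commuting x and y, the factor #|V :&: 'C[x] :&: 'C[y]| of leq_fiber_pairs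
    counts the v in V such that the cosets of x and y both lie in 'C_L[v] / V. *)
Lemma ncomm_lift :
    {in L & V, forall x v, [~ v, x] \in 'C[x] -> [~ v, x] = 1} ->
  (ncomm L <= #|V| * \sum_(v in V) ncomm ('C_L[v] / V))%N.
Proof.
move=> fpf; have nVL := normal_norm nsVL.
rewrite (ncomm_fibers (coset_morphism V) nVL).
pose S v := 'C_L[v] / V.
have bd a b : a \in L / V -> b \in L / V ->
    (fiber_pairs (coset V) L a b
       <= #|V| * \sum_(v in V) ((a \in S v) && (b \in 'C_(S v)[a])))%N.
  move=> La Lb; have [cab | ncab] := boolP (b \in 'C[a]); last first.
    by rewrite (@fiber_pairs_eq0 _ _ _ L (coset_morphism V)).
  have [-> // | nz] := eqVneq (fiber_pairs (coset V) L a b) 0%N.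
  have [x [y [Lx Ly ex ey cxy]]] : exists x y,
      [/\ x \in L, y \in L, coset V x = a, coset V y = b & y \in 'C[x]].
    move: nz; rewrite sum_nat_eq0 negb_forall_in => /exists_inP[x /andP[Lx /eqP ex]].
    rewrite cards_eq0 => /set0Pn[y]; rewrite in_set => /and3P[Ly /eqP ey cy].
    by exists x, y.
  rewrite -ex -ey; apply: leq_trans (leq_fiber_pairs Lx Ly cxy _) _.
    by move=> v Vv; apply: fpf.
  rewrite leq_mul2l; apply/orP; right.
  rewrite -sum1_card big_mkcond [leqRHS]big_mkcond; apply: leq_sum => v _ /=.
  rewrite !in_setI -andbA; case: (v \in V) => //=.
  case: andP => // [[cvx cvy]]; rewrite ex ey cab andbT -ex -ey.
  have Sx z : z \in L -> v \in 'C[z] -> coset V z \in S v.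
    by move=> Lz cvz; rewrite mem_quotient // in_setI Lz cent1C.
  by rewrite !Sx.
rewrite [leqLHS](_ : _ = \sum_(a in L / V) \sum_(b in L / V) fiber_pairs (coset V) L a b) //.
apply: (@leq_trans (\sum_(a in L / V) \sum_(b in L / V)
     #|V| * \sum_(v in V) ((a \in S v) && (b \in 'C_(S v)[a])))%N).
  by apply: leq_sum => a La; apply: leq_sum => b Lb; apply: bd.
under eq_bigr do rewrite -big_distrr /= exchange_big /=.
rewrite -big_distrr /= leq_mul2l exchange_big /=; apply/orP; right.
apply: leq_sum => v _; have sSL : S v \subset L / V by apply/quotientS/subsetIl.
rewrite /ncomm [leqRHS]big_mkcond [leqLHS]big_mkcond; apply: leq_sum => a _ /=.
case: ifP => // _; have [Sa | nSa] := boolP (a \in S v); last by rewrite /= big1.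
by rewrite /= sum_mem; apply/subset_leq_card/subsetIr.
Qed.

End Lift.

(** * Descending a chief series of the Fitting subgroup *)

Section ChiefSeries.
Local Open Scope group_scope.

(** If w = [~ v, x] is centralised by x then v ^ (x ^+ m) = v * w ^+ m, so the order
    of w divides both m and #|V|. *)
Lemma comm_cent_trivial (gT : finGroupType) (V : {group gT}) x v m :
    x \in 'N(V) -> v \in V -> coprime #|V| m -> v ^ (x ^+ m) = v ->
  [~ v, x] \in 'C[x] -> [~ v, x] = 1.
Proof.
move=> nVx Vv co fixm cw; set w := [~ v, x] in cw *.
have Vw : w \in V by rewrite /w commgEl groupM ?groupV // memJ_norm.
have wx : w ^ x = w by apply/conjg_fixP/commgP/cent1P.
have vx : v ^ x = v * w by rewrite /w commgEl mulKVg.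
have vxn n : v ^ (x ^+ n) = v * w ^+ n.
  elim: n => [|n IHn]; first by rewrite conjg1 mulg1.
  by rewrite expgSr conjgM IHn conjMg conjXg wx vx -mulgA -expgS.
have wm : w ^+ m = 1 by apply: (mulgI v); rewrite -vxn fixm mulg1.
have dm : #[w] %| m by rewrite order_dvdn wm.
have dV : #[w] %| #|V| := order_dvdG Vw.
by apply/eqP; rewrite -order_eq1 -dvdn1 -(eqP co) dvdn_gcd dV.
Qed.

Lemma nil_central_ext (gT : finGroupType) (A Z : {group gT}) :
  Z \subset 'Z(A) -> nilpotent (A / Z) -> nilpotent A.
Proof.
move=> sZ nilAZ; have nsZ : Z <| A := sub_center_normal sZ.
rewrite -quotient_center_nil -(isog_nil (third_isog sZ nsZ (center_normal A))).
exact: quotient_nil.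
Qed.

Variables (gT : finGroupType) (G : {group gT}).
Let F := 'F(G)%G.
Hypothesis nilGF : nilpotent (G / F).

Let nsFG : F <| G. Proof. exact: Fitting_normal. Qed.
Let nGF : G \subset 'N(F). Proof. exact: normal_norm. Qed.

(** The state reached after descending a chief series from F to Y. Ss is to consist of
    the intersections of stabilisers in G / F of points, one in each of the chief
    factors passed, #|F / Y| in all; the last clause bounds commuting
    pairs of L / Y by commuting pairs in these intersections. K is to be the
    common kernel on the chief factors passed, so that these are central in the preimage
    of K, which is therefore nilpotent modulo Y. *)
Definition chain_data (Y : {group gT}) (Ss : seq {group coset_of F})
    (K : {group coset_of F}) : Prop :=
  [/\ kgood (G / F)%G Ss K, (size Ss * #|Y| = #|F|)%N, K <| G / F,
      nilpotent (coset F @*^-1 K / Y)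
    & forall L : {group gT}, F \subset L -> L \subset G ->
      (ncomm (L / Y) * #|Y| <= #|F| * \sum_(X <- Ss) ncomm (L / F :&: X))%N].

Lemma chain_base : chain_data F [:: (G / F)%G] (G / F)%G.
Proof.
split=> [L sLG|||| L sFL sLG].
- by rewrite big_seq1 /= (setIidPl sLG) muln1 mulnC.
- by rewrite mul1n.
- exact: normal_refl.
- by rewrite quotientGK.
by rewrite big_seq1 /= (setIidPl (quotientS _ sLG)) mulnC.
Qed.

Section Step.
Variables (X Y : {group gT}) (Ss : seq {group coset_of F}) (K : {group coset_of F}).
Hypotheses (nsXG : X <| G) (nsYG : Y <| G) (sYX : Y \subset X) (sXF : X \subset F).
Hypothesis minV : minnormal (X / Y)%G (G / Y).
Hypothesis dataX : chain_data X Ss K.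

Let V := (X / Y)%G.
Let nGY : G \subset 'N(Y). Proof. exact: normal_norm. Qed.
Let sFG : F \subset G. Proof. exact: normal_sub. Qed.
Let ntV : V :!=: 1. Proof. by case/mingroupP: minV => /andP[]. Qed.
Let nVG : G / Y \subset 'N(V). Proof. by case/mingroupP: minV => /andP[]. Qed.
Let nsVG : V <| G / Y. Proof. exact: quotient_normal. Qed.

(** V is minimal normal in G / Y and meets the centre of the nilpotent normal
    subgroup F / Y, so F acts trivially on V. *)
Let cVF : F / Y \subset 'C(V).
Proof.
have nilF : nilpotent (F / Y) := quotient_nil Y (Fitting_nil G).
have nsFY : F / Y <| G / Y := quotient_normal Y nsFG.
have nsVF : V <| F / Y.
  by apply: normalS nsVG; [apply: quotientS | apply: normal_sub].
have ntZ := meet_center_nil nilF nsVF ntV.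
have nZ : G / Y \subset 'N(V :&: 'Z(F / Y)).
  by rewrite normsI // (char_norm_trans (center_char _)) // normal_norm.
have [_ /(_ (V :&: 'Z(F / Y))%G)] := mingroupP minV.
rewrite ntZ nZ => /(_ isT (subsetIl _ _)) /= eV.
have sVZ : V \subset 'Z(F / Y) by rewrite -[V : {set _}]eV subsetIr.
by rewrite centsC (subset_trans sVZ) // subsetIr.
Qed.

Let FY_V v : v \in V -> F \subset coset Y @*^-1 'C[v].
Proof.
move=> Vv; rewrite -sub_quotient_pre ?(subset_trans sFG) //.
by apply: subset_trans cVF _; rewrite -cent_set1 centS // sub1set.
Qed.

(** The new family consists of the intersections of the old ones with the
    stabilisers of points of V, given by aut_family for the action of G / F on V. *)
Lemma chain_step : exists Ss' K', chain_data Y Ss' K'.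
Proof.
have solF : solvable (F / Y) by rewrite quotient_sol // nilpotent_sol // Fitting_nil.
have sVF : V \subset F / Y by apply: quotientS.
have [_ _ /is_abelemP[q _ abV]] := minnormal_solvable minV sVF solF.
have rM : {in G &, {morph (fun g => conj_aut V (coset Y g)) : x y / x * y}}.
  move=> x y Gx Gy /=; rewrite morphM ?(subsetP nGY) //.
  by rewrite morphM // (subsetP nVG) ?mem_quotient.
pose r : {morphism G >-> {perm coset_of Y}} := Morphism rM.
have rE g v : g \in G -> v \in V -> r g v = v ^ coset Y g.
  by move=> Gg Vv; rewrite /= norm_conj_autE // (subsetP nVG) ?mem_quotient.
have kerr : 'ker (coset F) \subset 'ker r.
  rewrite ker_coset; apply/subsetP=> g Fg; have Gg := subsetP sFG g Fg.
  apply/kerP => //=; apply/mker; rewrite ker_conj_aut.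
  by rewrite (subsetP cVF) ?mem_quotient.
pose rho := factm_morphism kerr nGF.
have rhoE g : g \in G -> rho (coset F g) = r g by move=> Gg; apply: factmE.
have rhoE2 g v : g \in G -> v \in V -> rho (coset F g) v = v ^ coset Y g.
  by move=> Gg Vv; rewrite rhoE ?rE.
have rhoAut : rho @* (G / F) \subset Aut V.
  apply/subsetP=> _ /morphimP[_ _ /morphimP[g _ Gg ->] ->].
  rewrite rhoE //; apply: (subsetP (Aut_conj_aut V (G / Y))).
  by rewrite /= mem_morphim ?(subsetP nVG) ?mem_quotient.
have irr (U : {group coset_of Y}) : U \subset V ->
    {in G / F & U, forall h u, rho h u \in U} -> U :=: 1 \/ U :=: V.
  move=> sUV stabU; have [-> | ntU] := eqVneq (U :> {set _}) 1; first by left.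
  right; have [_ minV'] := mingroupP minV; apply: minV' => //; rewrite ntU /=.
  apply/subsetP=> _ /morphimP[g _ Gg ->]; rewrite inE; apply/subsetP=> _ /imsetP[u Uu ->].
  have <- := rhoE2 g u Gg (subsetP sUV u Uu).
  by apply: stabU; rewrite ?mem_quotient.
have [Ts [sizeT gT' q'rho famT]] := aut_family rhoAut abV ntV nilGF irr.
have [gS sizeS nsK nilDX boundX] := dataX.
have cardX : #|X| = (#|V| * #|Y|)%N.
  by rewrite card_quotient ?(subset_trans (subset_trans sXF sFG)) // mulnC Lagrange.
exists (meets Ss Ts), (K :&: 'ker rho)%G; split.
- exact: kgood_meets.
- by rewrite size_allpairs sizeT -mulnA -cardX.
- by rewrite /= normalI // ker_normal.
- pose D0 := (coset F @*^-1 K)%G; pose D := (coset F @*^-1 (K :&: 'ker rho))%G.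
  have sFD : F \subset D by rewrite /= -{1}[gval F]ker_coset kerE morphpreS ?sub1set ?group1.
  have sDG : D \subset G.
    by rewrite -(quotientGK nsFG) morphpreS // subIset // normal_sub.
  have sXD : X \subset D := subset_trans sXF sFD.
  have nsXD : X <| D by apply: normalS nsXG.
  have nsYD : Y <| D by apply: normalS nsYG => //; apply: subset_trans sXD.
  apply: (@nil_central_ext _ (D / Y)%G V).
    rewrite /= subsetI quotientS //=; rewrite centsC.
    apply/subsetP=> _ /morphimP[g nYg Dg ->]; have Gg := subsetP sDG g Dg.
    have [nFg /setIP[_ kg]] := morphpreP Dg.
    rewrite -ker_conj_aut; apply/kerP; first by rewrite (subsetP nVG) ?mem_quotient.
    by rewrite -[LHS]/(r g) -rhoE // (mker kg).
  rewrite (isog_nil (third_isog sYX nsYD nsXD)).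
  by apply: nilpotentS nilDX; rewrite quotientS // morphpreS ?subsetIl.
move=> L sFL sLG; pose Lv v := (L :&: coset Y @*^-1 'C[v])%G.
have nXL := subset_trans sLG (normal_norm nsXG).
have sFLv v : v \in V -> F \subset Lv v by move=> Vv; rewrite subsetI sFL FY_V.
have sLvG v : Lv v \subset G by rewrite subIset ?sLG.
have nsVL : V <| L / Y.
  apply: normalS nsVG; apply: quotientS => //.
  exact: subset_trans sXF sFL.
have sXL : X \subset L := subset_trans sXF sFL.
have eLv v : v \in V -> ncomm ('C_(L / Y)[v] / V) = ncomm (Lv v / X).
  move=> Vv; have sXLv := subset_trans sXF (sFLv v Vv).
  have nsXLv : X <| Lv v by apply: normalS nsXG.
  have nsYLv : Y <| Lv v by apply: normalS nsYG => //; apply: subset_trans sXLv.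
  rewrite -(ncomm_isog (third_isog sYX nsYLv nsXLv)) /=.
  by rewrite -quotient_setIpre.
have lift : (ncomm (L / Y) <= #|V| * \sum_(v in V) ncomm (Lv v / X))%N.
  under eq_bigr => v Vv do rewrite -eLv //.
  apply: (ncomm_lift nsVL (abelem_abelian abV)) => x v Lx Vv.
  have nVx := subsetP (normal_norm nsVL) x Lx.
  have co : coprime #|V| #|rho @* (G / F)|.
    exact: pnat_coprime (abelem_pgroup abV) q'rho.
  apply: (comm_cent_trivial nVx Vv co).
  case/morphimP: Lx => g nYg Lg ->; have Gg := subsetP sLG g Lg.
  have Gq : coset F g \in G / F by rewrite mem_quotient.
  rewrite -morphX // -rhoE2 ?groupX // morphX ?(subsetP nGF) // morphX //.
  by rewrite (expg_cardG (mem_morphim rho _ _)) // perm1.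
apply: leq_trans (leq_mul lift (leqnn _)) _.
rewrite mulnAC -cardX big_distrr /=.
apply: (@leq_trans (\sum_(v in V) #|F| * \sum_(S <- Ss) ncomm (Lv v / F :&: S))%N).
  by apply: leq_sum => v Vv; rewrite mulnC boundX ?sFLv ?sLvG.
rewrite -big_distrr /= leq_mul2l; apply/orP; right.
rewrite exchange_big big_allpairs_dep /=; apply: leq_sum => S _.
pose FS (A : {set coset_of F}) := ncomm (L / F :&: (S :&: A)).
have monF (A B : {group coset_of F}) : A \subset B -> (FS A <= FS B)%N.
  by move=> sAB; apply: ncommS; rewrite !setIS.
apply: leq_trans (famT FS monF (fun v => (Lv v / F)%G) _).
  apply: leq_sum => v Vv; apply: ncommS => /=.
  by rewrite !subsetI subsetIr subsetIl andbT subIset // quotientS ?subsetIl.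
move=> v Vv; split; first exact: quotientS.
move=> _ /morphimP[g nFg /setIP[Lg /morphpreP[nYg cvg]] ->].
rewrite rhoE2 ?(subsetP sLG) //; apply/conjg_fixP/commgP/commute_sym.
exact/cent1P.
Qed.

End Step.

Lemma chain_exists (Y : {group gT}) : Y <| G -> Y \subset F -> exists Ss K, chain_data Y Ss K.
Proof.
have [n] := ubnP (#|F| - #|Y|); elim: n Y => // n IHn Y ltn nsYG sYF.
have [eYF | neYF] := eqVneq (Y :> {set gT}) F.
  by exists [:: (G / F)%G], (G / F)%G; rewrite (val_inj eYF); apply: chain_base.
have nYG := normal_norm nsYG; have sFG := normal_sub nsFG.
have ntFY : F / Y != 1.
  by rewrite quotient_neq1 ?(normalS sYF sFG) // properEneq neYF.
have nFY : G / Y \subset 'N(F / Y) by rewrite quotient_norms.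
have [V minV sVF] : {V : {group coset_of Y} | minnormal V (G / Y) & V \subset F / Y}.
  by apply: mingroup_exists; rewrite ntFY nFY.
have [/andP[ntV nVG] _] := mingroupP minV.
have nsV : V <| G / Y.
  by rewrite /normal nVG (subset_trans sVF) ?quotientS.
have [X eV sYX nsXG] := inv_quotientN nsYG nsV.
have eV' : V = (X / Y)%G by apply: val_inj.
have sXF : X \subset F.
  by rewrite -(quotientSGK _ sYF) -?eV // (subset_trans (normal_sub nsXG)).
have ltYX : (#|Y| < #|X|)%N.
  apply: proper_card; rewrite properE sYX /=; apply: contra ntV => sXY.
  by rewrite eV' /= -subG1 quotient_sub1 // (subset_trans (normal_sub nsXG)).
have leXF := subset_leq_card sXF.
have [|Ss [K dataX]] := IHn X _ nsXG sXF; first by move: ltn ltYX leXF; clear; lia.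
by apply: (chain_step nsXG nsYG sYX sXF _ dataX); rewrite -eV'.
Qed.

(** At the bottom of the series the preimage of K is a nilpotent normal subgroup of
    G, hence equal to F, so K is trivial and kgood applies in G / F itself. *)
Lemma metanilpotent_ncomm : (ncomm G <= #|F| * #|G|)%N.
Proof.
have [Ss [K [gS sizeS nsK nilD bound]]] := chain_exists (normal1 G) (sub1G F).
have sFG := normal_sub nsFG.
pose D := (coset F @*^-1 K)%G.
have nilDD : nilpotent D.
  by rewrite (isog_nil (quotient1_isog D)).
have nsD : D <| G by rewrite -(quotientGK nsFG) cosetpre_normal.
have K1 : K :=: 1.
  apply/trivgP; rewrite -(cosetpreK K) -/(gval D).
  by rewrite -trivg_quotient quotientS //; apply: Fitting_max.
have := gS (G / F)%G (subxx _); rewrite /= K1 (setIidPr (sub1G _)) cards1 ncomm1 !muln1.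
move: sizeS; rewrite cards1 muln1 => -> leG.
have := bound G sFG (subxx _).
rewrite cards1 muln1 -(ncomm_isog (quotient1_isog G)) => /leq_trans-> //.
rewrite leq_mul2l; apply/orP; right; apply: leq_trans leG _.
by rewrite card_quotient // mulnC Lagrange.
Qed.
End ChiefSeries.

(** * Commuting pairs in solvable groups *)

Section CommutingProbability.
Local Open Scope group_scope.

(** In terms of probabilities, cp(G) * cp(G / F) <= 1 / #|G : F| with F the Fitting
    subgroup. Let F2 / F be the Fitting subgroup of Q = G / F. Then F2 is
    metanilpotent with Fitting subgroup F, so cp(F2) <= 1 / #|F2 : F|, and the
    induction hypothesis for Q bounds cp(Q) * cp(G / F2) by 1 / #|G : F2|. *)
Lemma ncomm_two_step (gT : finGroupType) (G : {group gT}) : solvable G ->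
  (ncomm G * ncomm (G / 'F(G)) <= #|G| ^ 2 * #|G : 'F(G)|)%N.
Proof.
have [n] := ubnP #|G|; elim: n gT G => // n IHn gT G ltGn solG.
have nsF : 'F(G) <| G := Fitting_normal G; have nFG := normal_norm nsF.
pose Q := (G / 'F(G))%G; have solQ : solvable Q := quotient_sol _ solG.
have cardQ : #|Q| = #|G : 'F(G)| by rewrite card_quotient.
have [G1 | ntG] := eqVneq (G :> {set gT}) 1.
  have Q1 : #|Q| = 1%N.
    have cG1 : #|G| = 1%N by rewrite G1 cards1.
    by apply/eqP; rewrite cardQ -dvdn1 -cG1 dvdn_indexg.
  have leQ : (ncomm Q <= 1)%N by have := ncomm_le Q; rewrite Q1.
  by rewrite -cardQ Q1 muln1; apply: leq_trans (leq_mul (ncomm_le G) leQ) _; rewrite muln1.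
have ltQ : (#|Q| < n)%N.
  rewrite ltnS in ltGn; apply: leq_trans ltGn; rewrite ltn_quotient ?normal_sub //.
  by rewrite trivg_Fitting.
pose F2 := (coset 'F(G) @*^-1 'F(Q))%G.
have nsF2 : F2 <| G by rewrite -(quotientGK nsF) cosetpre_normal Fitting_normal.
have sFF2 : 'F(G) \subset F2 by rewrite -{1}['F(G)]ker_coset kerE morphpreS ?sub1set ?group1.
have eF : 'F(F2)%G = 'F(G)%G.
  apply/val_inj/eqP; rewrite eqEsubset; apply/andP; split.
    by apply: Fitting_max; rewrite ?Fitting_nil // (char_normal_trans (Fitting_char _)).
  by apply: Fitting_max; rewrite ?Fitting_nil // (normalS _ (normal_sub nsF2)).
have nilF2 : nilpotent (F2 / 'F(F2)%G) by rewrite eF /= cosetpreK Fitting_nil.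
have nF2 : (ncomm F2 <= #|'F(G)| * #|F2|)%N.
  by have := metanilpotent_ncomm nilF2; rewrite eF.
have iso : Q / 'F(Q) \isog G / F2.
  have nsF2' : F2 / 'F(G) <| Q by rewrite quotient_normal.
  by have := third_isog sFF2 nsF nsF2; rewrite /= cosetpreK.
have IHQ := IHn _ Q ltQ solQ; rewrite (ncomm_isog iso) in IHQ.
have cardQ2 : #|Q : 'F(Q)| = #|G : F2|.
  by rewrite -!card_quotient ?normal_norm ?Fitting_normal // (card_isog iso).
rewrite cardQ2 in IHQ.
have qG : (ncomm G <= ncomm (G / F2) * ncomm F2)%N := ncomm_quotient nsF2.
have LF : (#|'F(G)| * #|G : 'F(G)| = #|G|)%N := Lagrange (normal_sub nsF).
have LF2 : (#|F2| * #|G : F2| = #|G|)%N := Lagrange (normal_sub nsF2).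
rewrite -/(gval Q) -[_ / _]/(gval Q).
apply: leq_trans (leq_mul qG (leqnn _)) _; rewrite mulnAC -mulnA.
apply: leq_trans (leq_mul (leqnn _) (leq_mul (leqnn _) nF2)) _.
rewrite mulnA [X in (X * _ <= _)%N]mulnC.
apply: leq_trans (leq_mul IHQ (leqnn _)) _; rewrite cardQ.
apply/eq_leq.
transitivity ((#|F2| * #|G : F2|) * (#|'F(G)| * #|G : 'F(G)|) * #|G : 'F(G)|)%N; first by ring.
by rewrite LF LF2 mulnn.
Qed.

(** Since cp(G) <= cp(G / F), the square of cp(G) is at most the product bounded in
    ncomm_two_step. *)
Lemma ncomm_sqr_index (gT : finGroupType) (G : {group gT}) : solvable G ->
  (ncomm G ^ 2 * #|G : 'F(G)| <= #|G| ^ 4)%N.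
Proof.
move=> solG; have nsF := Fitting_normal G; have nFG := normal_norm nsF.
have q1 : (ncomm G <= ncomm (G / 'F(G)) * #|'F(G)| ^ 2)%N.
  exact: leq_trans (ncomm_quotient nsF) (leq_mul (leqnn _) (ncomm_le _)).
have LF : (#|'F(G)| * #|G : 'F(G)| = #|G|)%N := Lagrange (normal_sub nsF).
rewrite -mulnn -mulnA.
apply: leq_trans (leq_mul (leqnn _) (leq_mul q1 (leqnn _))) _.
rewrite !mulnA -2!mulnA.
apply: leq_trans (leq_mul (ncomm_two_step solG) (leqnn _)) _.
apply/eq_leq; transitivity (#|G| ^ 2 * (#|'F(G)| * #|G : 'F(G)|) ^ 2)%N; first by ring.
by rewrite LF -expnD.
Qed.

End CommutingProbability.

(** * Cyclic subgroups and involutions *)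

Section CyclicSubgroups.
Local Open Scope group_scope.
Variables (gT : finGroupType) (G : {group gT}).

Definition involutive : {set gT} := [set x in G | x ^+ 2 == 1].

(** Assign to each element the cyclic subgroup that it generates. A cyclic subgroup
    of order at most 2 has a generator in G and the same one among the elements
    with x ^+ 2 = 1; any other has two different generators x and x^-1. *)
Lemma leq_card_cyclic : (2 * #|cyclic_subgroups G| <= #|G| + #|involutive|)%N.
Proof.
have cyc x : x \in G -> <[x]>%G \in cyclic_subgroups G.
  by move=> Gx; rewrite in_set in_set cycle_subG Gx cycle_cyclic.
have sI : involutive \subset G by apply/subsetP=> x; rewrite inE => /andP[].
rewrite -!sum1_card (partition_big (fun x => <[x]>%G) (mem (cyclic_subgroups G))) //=.
rewrite (partition_big (fun x => <[x]>%G) (mem (cyclic_subgroups G))) /=; last first.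
  by move=> x /(subsetP sI); apply: cyc.
rewrite -big_split big_distrr /=; apply: leq_sum => H.
rewrite in_set in_set muln1 => /andP[sHG /cyclicP[x eH]].
have Gx : x \in G by rewrite -cycle_subG -eH.
have ex : <[x]>%G == H by apply/eqP/val_inj.
have [x2 | nx2] := boolP (x ^+ 2 == 1).
  rewrite (bigD1 x) ?Gx //= [X in (_ <= _ + X)%N](bigD1 x) /=; last by rewrite in_set Gx x2.
  by rewrite addnCA -addnA !addnA; lia.
rewrite (bigD1 x) ?Gx //= (bigD1 x^-1) /=; first by lia.
rewrite groupV Gx -val_eqE /= cycleV -eH eqxx /=.
by apply: contra nx2 => /eqP xV; rewrite expgS expg1 -{1}xV mulVg.
Qed.

(** If s ^+ 2 = t ^+ 2 = 1 and s * t = g then s inverts g, so for given g the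
    possible s lie in one coset of the centraliser of g. *)
Lemma involutive_sqr_leq : (#|involutive| ^ 2 <= ncomm G)%N.
Proof.
have inv x : x \in involutive -> x \in G /\ x^-1 = x.
  by rewrite in_set => /andP[Gx /eqP x2]; split=> //; apply/eqP; rewrite eq_invg_mul; apply/eqP.
rewrite -mulnn -cardsX -sum1_card.
rewrite (partition_big (fun p : gT * gT => p.1 * p.2) (mem G)) /=; last first.
  by move=> [s t]; rewrite in_setX => /andP[/inv[Gs _] /inv[Gt _]]; rewrite groupM.
rewrite /ncomm; apply: leq_sum => g Gg; rewrite sum1_card.
set P := (X in (#|X| <= _)%N); have [[s0 t0] P0 | P0] := pickP P; last by rewrite eq_card0.
have invP s t : (s, t) \in P -> [/\ s \in G, s * t = g & g ^ s = g^-1].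
  rewrite unfold_in /= in_setX => /andP[/andP[/inv[Gs sV] /inv[Gt tV]] /eqP eg]; split=> //.
  by rewrite -eg invMg sV tV conjgE -mulgA mulKg.
have [Gs0 _ gs0] := invP _ _ P0.
apply: leq_trans (leq_imset_card (fun c => (c^-1 * s0, (c^-1 * s0)^-1 * g)) 'C_G[g]).
apply/subset_leq_card/subsetP=> -[s t] Pst; have [Gs est gs] := invP _ _ Pst.
apply/imsetP; exists (s0 * s^-1); last by rewrite invMg invgK mulgKV -est mulKg.
rewrite in_setI groupM ?groupV //=; apply/cent1P/commute_sym/commgP/conjg_fixP.
by rewrite conjgM gs0 -gs conjgK.
Qed.

End CyclicSubgroups.

(** * Probabilities *)

Lemma card_commuting_pairs (gT : finGroupType) (G : {group gT}) :
  #|commuting_pairs G| = ncomm G.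
Proof.
pose prs := [set p | (p.1 \in G) && (p.2 \in ('C_G[p.1])%g)].
have -> : commuting_pairs G = prs.
  by apply/setP=> -[x y]; rewrite in_set [RHS]in_set /= in_setX in_setI cent1E eq_sym; case: (x \in G).
rewrite -sum1_card /ncomm; under [RHS]eq_bigr do rewrite -sum1_card.
by rewrite pair_big_dep; apply: eq_bigl => p; rewrite inE.
Qed.

Import Order.TTheory GRing.Theory Num.Theory.
Local Open Scope ring_scope.

Lemma cpE (gT : finGroupType) (G : {group gT}) :
  cp G = (ncomm G)%:R / #|G|%:R ^+ 2.
Proof. by rewrite /cp card_commuting_pairs cardsX natrM expr2. Qed.

Lemma cp_sqr_index (gT : finGroupType) (G : {group gT}) : solvable G ->
  cp G ^+ 2 * #|G : 'F(G)|%g%:R <= 1.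
Proof.
move=> solG; have g0 : 0 < #|G|%:R ^+ 4 :> rat by rewrite exprn_gt0 // ltr0n cardG_gt0.
rewrite cpE expr_div_n -exprM mulrAC ler_pdivrMr // mul1r -!natrX -natrM ler_nat.
exact: ncomm_sqr_index.
Qed.

Lemma alpha_sqr_cp (gT : finGroupType) (G : {group gT}) :
  0 <= 2 * alpha G - 1 -> (2 * alpha G - 1) ^+ 2 <= cp G.
Proof.
move=> a0; have g0 : 0 < #|G|%:R :> rat by rewrite ltr0n cardG_gt0.
have leI : 2 * alpha G - 1 <= #|involutive G|%:R / #|G|%:R.
  rewrite lerBlDr /alpha mulrA -[X in _ + X](divff (lt0r_neq0 g0)) -mulrDl.
  by rewrite ler_pM2r ?invr_gt0 // -natrD -natrM ler_nat addnC leq_card_cyclic.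
apply: le_trans (_ : (#|involutive G|%:R / #|G|%:R) ^+ 2 <= _).
  by rewrite lerXn2r ?nnegrE // (le_trans a0).
by rewrite cpE expr_div_n ler_pM2r ?invr_gt0 ?exprn_gt0 // -natrX ler_nat involutive_sqr_leq.
Qed.

Theorem mainTheorem13 (gT : finGroupType) (G : {group gT})
    (solG : solvable G) :
  (forall R : rcfType,
     ratr (cp G) <= (Num.sqrt (#|G : 'F(G)|%g%:R : R))^-1)
  /\ (1 / 2 < alpha G ->
      #|G : 'F(G)|%g%:R <= (2 * alpha G - 1) ^- 4).
Proof.
have cp0 : 0 <= cp G by rewrite cpE divr_ge0 ?exprn_ge0 ?ler0n.
have le1 := cp_sqr_index solG; split=> [R | alpha_gt].
  have idx0 : 0 < (#|G : 'F(G)|%g%:R : R) by rewrite ltr0n indexg_gt0.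
  have cpR0 : 0 <= ratr (cp G) :> R by rewrite ler0q.
  rewrite -[leRHS]mul1r ler_pdivlMr ?sqrtr_gt0 //.
  rewrite -(ger0_norm cpR0) -sqrtr_sqr -sqrtrM ?exprn_ge0 // -[leRHS]sqrtr1.
  rewrite ler_wsqrtr //.
  have : ratr (cp G ^+ 2 * #|G : 'F(G)|%g%:R) <= ratr 1 :> R by rewrite ler_rat.
  by rewrite rmorphM rmorphXn /= ratr_nat rmorph1.
have a0 : 0 < 2 * alpha G - 1 by rewrite subr_gt0 -ltr_pdivrMl // mulr1 -[X in X < _]mul1r.
rewrite -[leRHS]mul1r ler_pdivlMr ?exprn_gt0 // (le_trans _ le1) // mulrC.
rewrite ler_wpM2r ?ler0n // (exprM _ 2 2) lerXn2r ?nnegrE ?(exprn_ge0 _ (ltW a0)) //.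
by apply: alpha_sqr_cp; apply: ltW.
Qed.
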